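(* Let $a$ and $\lambda$ be positive constants and let $u(y)$ and $v(y)$ be $C^2$ solutions of the system $$0\le-\Delta u\le |y|^a e^{|v|^\lambda},\qquad u(y)>-a\log|y|,$$ $$0\le-\Delta v\le |y|^a e^{u},\qquad v(y)>-a\log|y|,$$ in the complement of a compact subset of $\mathbb{R}^2$. Then $$u(y)=O(\log|y|)+o\left((\log|y|)^\lambda\right)\quad\text{and}\quad v(y)=O(\log|y|)\quad\text{as }|y|\to\infty.$$
   Context: An identity $u=O(k_1)+o(k_2)$ means that $u$ is the sum of a function that is $O(k_1)$ and a function that is $o(k_2)$ in the indicated limit. *)

(* Defs.v *)
From Stdlib Require Export Reals List.
From Coquelicot Require Export Coquelicot.
Open Scope R_scope.

(* [Rpower 0 p = 1] because Stdlib sets [ln 0 = 0]; here [0 ^ p = 0], as it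
   should be for [0 < p]. Only meant for [0 <= x]. *)
Definition rpow (x p : R) : R :=
  if Req_dec_T x 0 then 0 else Rpower x p.

Definition compact_set {T : UniformSpace} (K : T -> Prop) : Prop :=
  forall F : (T -> Prop) -> Prop,
    (forall U, F U -> open U) ->
    (forall x, K x -> exists U, F U /\ U x) ->
    exists l : list (T -> Prop),
      (forall U, In U l -> F U) /\
      (forall x, K x -> exists U, In U l /\ U x).

(* The plane is [R * R], and [Cmod y = sqrt (fst y ^ 2 + snd y ^ 2)] serves as
   its Euclidean norm. *)

Definition C2_on (Omega : R * R -> Prop) (u : R * R -> R) : Prop :=
  forall y, Omega y -> ex_diff_n (fun s t => u (s, t)) 2 (fst y) (snd y).

Definition laplacian (u : R * R -> R) (y : R * R) : R :=
  partial_derive 2 0 (fun s t => u (s, t)) (fst y) (snd y) +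
  partial_derive 0 2 (fun s t => u (s, t)) (fst y) (snd y).

Definition at_infinity (P : R * R -> Prop) : Prop :=
  exists M : R, forall y, M < Cmod y -> P y.

Definition is_bigO {T : Type} (F : (T -> Prop) -> Prop) (k f : T -> R) : Prop :=
  exists C : R, F (fun x => Rabs (f x) <= C * Rabs (k x)).

(* [is_domin F k f] is [f = o(k)] along [F]. *)
Definition is_littleo {T : Type} (F : (T -> Prop) -> Prop) (k f : T -> R) : Prop :=
  is_domin F k f.

Definition is_bigO_plus_littleo {T : Type} (F : (T -> Prop) -> Prop)
    (k1 k2 u : T -> R) : Prop :=
  exists f g : T -> R,
    (forall x, u x = f x + g x) /\ is_bigO F k1 f /\ is_littleo F k2 g.

(* Main.v *)
Require Import Defs.
From Stdlib Require Import Lra ClassicalEpsilon.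

(** Write [y = e^s (cos t, sin t)].  In the coordinates [(s, t)] the exterior
    of a disc becomes a half cylinder [s > t1], [2 PI]-periodic in [t], and
    the Laplacian is only multiplied by [e^(2s)].  There [P = u + a s] and
    [Q = v + a s] are positive superharmonic functions, and [F = - Delta P],
    [G = - Delta Q] satisfy [F <= e^((a+2)s) e^(|v|^lam)] and
    [G <= e^((a+2)s) e^u].

    The mean of [P] over the circle [t in [0, 2 PI]] is concave in [s] and
    positive, so it grows at most linearly and its slope converges; hence the
    integral of [F] over [[s-1, s+1] x [0, 2 PI]] tends to [0] as [s -> oo].
    The same holds for [Q] and [G] ([half_cylinder_mass]).  On the other hand
    [P] at a point is its mean over the unit circle around the point plus the
    logarithmic potential of [F] on the unit disc ([circle_representation]),
    and the circle mean is at most a multiple of [s] because it decreases in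
    the radius and integrates to at most a strip integral of [P].  So
    [P <= C s + logpot F] and [Q <= C s + logpot G] ([half_cylinder_bound]).

    Two facts on potentials finish the proof.  If [G <= e^(L/2)] near a point
    then [logpot G <= L m + 4], with [m] the mass of [G] on the unit disc: at
    distance above [e^(-L/2)] from the point the logarithm costs at most a
    multiple of [L m], and nearer the disc is so small that the bound on [G]
    makes the rest [O(1)].  This remains true if only
    [G <= e^(L/2) e^(logpot F)], provided that [F] has mass at most [1/2] on
    unit discs: by Jensen's inequality [e^(logpot F)] is then controlled by a
    potential with kernel [|z|^(-1/2)] ([logpot_le_of_exp]), a special case
    of the Brezis--Merle inequality.

    The second fact, with [L = O(s)] (from [G <= e^((a+2)s) e^u] and the bound
    on [P]), gives [Q = O(s)], so [v = O(s)].  Then [F <= e^(L/2)] with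
    [L = O(s + s^lam)], and the first fact gives [logpot F <= L m + 4] with
    [m -> 0], which is [O(s) + o(s^lam)].

    All potentials are written with circle means, so that only iterated
    one-dimensional integrals occur.  Functions are made continuous on the
    whole plane by freezing [s] below [t1]; this spares every integral a
    discussion of its domain. *)

(** * Continuous functions and their Riemann integrals *)

Definition cont {X Y : UniformSpace} (f : X -> Y) : Prop :=
  forall x, continuous f x.

Lemma cont_ext {X : UniformSpace} (f g : X -> R) :
  (forall x, f x = g x) -> cont f -> cont g.
Proof. intros H Hf x. now apply continuous_ext with (2 := Hf x). Qed.

Lemma cont_const {X : UniformSpace} (c : R) : cont (fun _ : X => c).
Proof. intros x. apply continuous_const. Qed.

Lemma cont_id {X : UniformSpace} : cont (fun x : X => x).
Proof. intros x. apply continuous_id. Qed.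

Lemma cont_comp {X Y Z : UniformSpace} (g : X -> Y) (f : Y -> Z) :
  cont g -> cont f -> cont (fun x => f (g x)).
Proof. intros Hg Hf x. now apply continuous_comp. Qed.

Lemma cont_fst {X Y Z : UniformSpace} (g : X -> Y * Z) :
  cont g -> cont (fun x => fst (g x)).
Proof.
  intros Hg. apply (cont_comp g fst Hg). intros [y z]. apply continuous_fst.
Qed.

Lemma cont_snd {X Y Z : UniformSpace} (g : X -> Y * Z) :
  cont g -> cont (fun x => snd (g x)).
Proof.
  intros Hg. apply (cont_comp g snd Hg). intros [y z]. apply continuous_snd.
Qed.

Lemma cont_plus {X : UniformSpace} (f g : X -> R) :
  cont f -> cont g -> cont (fun x => f x + g x).
Proof. intros Hf Hg x. now apply (continuous_plus f g). Qed.

Lemma cont_opp {X : UniformSpace} (f : X -> R) :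
  cont f -> cont (fun x => - f x).
Proof. intros Hf x. now apply (continuous_opp f). Qed.

Lemma cont_minus {X : UniformSpace} (f g : X -> R) :
  cont f -> cont g -> cont (fun x => f x - g x).
Proof. intros Hf Hg x. now apply (continuous_minus f g). Qed.

Lemma cont_mult {X : UniformSpace} (f g : X -> R) :
  cont f -> cont g -> cont (fun x => f x * g x).
Proof. intros Hf Hg x. now apply (continuous_mult f g). Qed.

Definition cont2 (f : R -> R -> R) : Prop := cont (fun p : R * R => f (fst p) (snd p)).

Lemma cont2_comp {X : UniformSpace} (f : R -> R -> R) (e1 e2 : X -> R) :
  cont2 f -> cont e1 -> cont e2 -> cont (fun x => f (e1 x) (e2 x)).
Proof.
  intros Hf H1 H2 x. apply continuous_comp_2; [apply H1 | apply H2 | apply Hf].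
Qed.

Lemma cont_sin : cont sin.
Proof. intros x. apply continuous_sin. Qed.
Lemma cont_cos : cont cos.
Proof. intros x. apply continuous_cos. Qed.
Lemma cont_exp : cont exp.
Proof. intros x. apply continuous_exp. Qed.
Lemma cont_sqrt : cont sqrt.
Proof. intros x. apply continuous_sqrt. Qed.

Lemma cont_ex_RInt (f : R -> R) a b : cont f -> ex_RInt f a b.
Proof. intros Hf. apply (ex_RInt_continuous f). intros; apply Hf. Qed.

Lemma cont2_continuity_2d f x y : cont2 f -> continuity_2d_pt f x y.
Proof. intros H. apply continuity_2d_pt_filterlim. apply (H (x, y)). Qed.

Lemma cont_slice {X : UniformSpace} (h : X -> R -> R) (x : X) :
  cont (fun p : X * R => h (fst p) (snd p)) -> cont (h x).
Proof.
  intros H t.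
  apply (continuous_comp_2 (fun _ : R => x) (fun t : R => t) h).
  - apply continuous_const.
  - apply continuous_id.
  - apply (H (x, t)).
Qed.

Lemma RInt_Rext (f g : R -> R) a b : (forall x, f x = g x) -> RInt f a b = RInt g a b.
Proof. intros H. apply RInt_ext. intros; apply H. Qed.

Lemma RInt_Rcomp_lin (f : R -> R) u v a b : cont f ->
  RInt (fun t => u * f (u * t + v)) a b = RInt f (u * a + v) (u * b + v).
Proof. intros Hf. apply (RInt_comp_lin f). now apply cont_ex_RInt. Qed.

Lemma RInt_Rmult (f : R -> R) a b c : cont f ->
  RInt (fun x => c * f x) a b = c * RInt f a b.
Proof. intros H. apply (RInt_scal f a b c). now apply cont_ex_RInt. Qed.

Lemma RInt_Rplus (f g : R -> R) a b : cont f -> cont g ->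
  RInt (fun x => f x + g x) a b = RInt f a b + RInt g a b.
Proof. intros H H'. apply (RInt_plus f g a b); now apply cont_ex_RInt. Qed.

Lemma RInt_le_cont (f g : R -> R) a b : a <= b -> cont f -> cont g ->
  (forall x, a <= x <= b -> f x <= g x) -> RInt f a b <= RInt g a b.
Proof.
  intros Hab Hf Hg H. apply RInt_le; trivial; try now apply cont_ex_RInt.
  intros; apply H; lra.
Qed.

Lemma RInt_nonneg (f : R -> R) a b : a <= b -> cont f ->
  (forall x, a <= x <= b -> 0 <= f x) -> 0 <= RInt f a b.
Proof.
  intros Hab Hf H. apply RInt_ge_0; trivial; try now apply cont_ex_RInt.
  intros; apply H; lra.
Qed.

(** The parameter space [X] is arbitrary because some integrands below depend on
    two parameters; the uniformity comes from the compactness of the interval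
    of integration. *)
Lemma cont_RInt {X : UniformSpace} (h : X -> R -> R) a b : a <= b ->
  cont (fun p : X * R => h (fst p) (snd p)) ->
  cont (fun x => RInt (h x) a b).
Proof.
  intros Hab H x0.
  apply filterlim_locally. intros eps.
  assert (He : 0 < eps / (3 * (b - a + 1))).
  { apply Rdiv_lt_0_compat. apply cond_pos. lra. }
  set (e := mkposreal _ He).
  assert (Hd : forall t : R, exists d : posreal, forall x s,
     ball x0 d x -> Rabs (s - t) < d -> Rabs (h x s - h x0 t) < e).
  { intros t.
    destruct (proj1 (filterlim_locally _ _) (H (x0, t)) e) as [d Hd].
    exists d. intros x s Hx Hs. apply (Hd (x, s)). now split. }
  apply (Hierarchy.filter_imp (fun x => forall s, a <= s <= b -> Rabs (h x s - h x0 s) <= 2 * e)).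
  { intros x Hx. change (Rabs (RInt (h x) a b - RInt (h x0) a b) < eps).
    pose proof (cont_slice h x H) as Cx. pose proof (cont_slice h x0 H) as Cx0.
    replace (RInt (h x) a b - RInt (h x0) a b) with (RInt (fun s => h x s - h x0 s) a b).
    2: { apply (RInt_minus (h x) (h x0)); now apply cont_ex_RInt. }
    apply Rle_lt_trans with ((b - a) * (2 * e)).
    - apply (norm_RInt_le_const (fun s => h x s - h x0 s) a b); trivial.
      apply (@RInt_correct R_CompleteNormedModule). apply cont_ex_RInt. apply cont_minus; trivial.
    - unfold e; simpl. pose proof (cond_pos eps).
      replace ((b - a) * (2 * (eps / (3 * (b - a + 1))))) with (eps * ((2 * (b-a)) / (3 * (b - a + 1)))) by (field; lra).
      rewrite <- (Rmult_1_r eps) at 2. apply Rmult_lt_compat_l; trivial.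
      apply Rlt_div_l; lra. }
  assert (Hdelta : exists delta : R -> posreal, forall t x s,
     ball x0 (delta t) x -> Rabs (s - t) < delta t -> Rabs (h x s - h x0 t) < e).
  { exists (fun t => proj1_sig (constructive_indefinite_description _ (Hd t))).
    intros t. apply (proj2_sig (constructive_indefinite_description _ (Hd t))). }
  destruct Hdelta as [delta Hdelta].
  destruct (compactness_value_1d a b delta) as [d Hdd].
  exists d. intros x Hx s Hs. apply Rnot_lt_le. intros Hlt.
  apply (Hdd s Hs). intros [t [Ht [Hst Hdt]]].
  pose proof (Hdelta t x s (ball_le _ _ _ Hdt _ Hx) Hst).
  pose proof (Hdelta t x0 s (ball_center _ _) Hst).
  apply (Rlt_irrefl (2 * e)). apply Rlt_trans with (1 := Hlt).
  replace (h x s - h x0 s) with ((h x s - h x0 t) - (h x0 s - h x0 t)) by ring.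
  eapply Rle_lt_trans. apply Rabs_triang. rewrite Rabs_Ropp. lra.
Qed.

(** [r ln (1/r)] is the density in [r] of the kernel [ln (1/|z|)] against
    circle means.  The convention [ln r = 0] for [r <= 0] makes it continuous
    on the whole line. *)
Definition log_weight (r : R) : R := - (r * ln r).

Lemma log_weight_nonpos r : r <= 0 -> log_weight r = 0.
Proof.
  intros Hr. unfold log_weight, ln. destruct (Rlt_dec 0 r) as [H | _]; [exfalso; lra | ring].
Qed.

Lemma log_weight_0 : log_weight 0 = 0.
Proof. unfold log_weight. ring. Qed.

(** The tangent inequality [ln x <= x - 1] at [x = e^(-L/2) / sqrt r].  The free
    parameter [L] serves twice: as a cut-off of the logarithm at radius
    [e^(-L/2)], and as the point of tangency in Jensen's inequality. *)
Lemma log_weight_le (L r : R) : 0 <= r -> log_weight r <= (L - 2) * r + 2 * exp (- (L / 2)) * sqrt r.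
Proof.
  intros [Hr | <-].
  2: { rewrite log_weight_0, sqrt_0. lra. }
  pose proof (sqrt_lt_R0 r Hr) as Hs. pose proof (sqrt_sqrt r (Rlt_le _ _ Hr)) as Hss.
  set (s := sqrt r) in *. set (e := exp (- (L / 2))).
  assert (He : 0 < e) by apply exp_pos.
  assert (Hes : 0 < e / s) by now apply Rdiv_lt_0_compat.
  assert (Hln : ln r = - L - 2 * ln (e / s)).
  { rewrite ln_div by trivial. unfold e. rewrite ln_exp.
    rewrite <- Hss, ln_mult by trivial. lra. }
  assert (Hle : ln (e / s) <= e / s - 1).
  { pose proof (exp_ineq1_le (ln (e / s))) as H. rewrite exp_ln in H by trivial. lra. }
  unfold log_weight. rewrite Hln, <- Hss.
  replace (2 * e * s) with (s * s * (2 * (e / s))) by (field; lra).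
  assert (0 <= s * s) by nra. nra.
Qed.

Lemma log_weight_nonneg r : r <= 1 -> 0 <= log_weight r.
Proof.
  intros Hr. destruct (Rle_or_lt r 0) as [H | H].
  - rewrite log_weight_nonpos; lra.
  - unfold log_weight. assert (ln r <= 0) by (rewrite <- ln_1; apply ln_le; lra). nra.
Qed.

Lemma cont_log_weight : cont log_weight.
Proof.
  intros r. destruct (total_order_T r 0) as [[Hr | ->] | Hr].
  - apply continuous_ext_loc with (fun _ => 0); [ | apply continuous_const].
    apply Hierarchy.filter_imp with (2 := open_lt 0 r Hr). intros x Hx.
    symmetry. apply log_weight_nonpos. now apply Rlt_le.
  - apply filterlim_locally. intros eps.
    assert (Hc := proj1 (filterlim_locally _ _) (cont_sqrt 0) (mkposreal _ (is_pos_div_2 eps))).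
    apply Hierarchy.filter_imp with (2 := filter_and _ _ Hc (locally_ball (0 : R_UniformSpace) posreal_one)).
    intros x [H1 H2]. change (Rabs (x - 0) < 1) in H2.
    change (Rabs (sqrt x - sqrt 0) < eps / 2) in H1. change (Rabs (log_weight x - log_weight 0) < eps).
    rewrite sqrt_0, Rminus_0_r in H1. rewrite Rminus_0_r in H2. rewrite log_weight_0, Rminus_0_r.
    apply Rabs_def2 in H2. apply Rabs_def2 in H1.
    destruct (Rle_or_lt x 0) as [H | H].
    + rewrite log_weight_nonpos, Rabs_R0 by trivial. apply cond_pos.
    + rewrite Rabs_right by (apply Rle_ge, log_weight_nonneg; lra).
      assert (Hk := log_weight_le 0 x (Rlt_le _ _ H)).
      replace (- (0 / 2)) with 0 in Hk by field. rewrite exp_0 in Hk. lra.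
  - apply (continuous_opp (fun r => r * ln r)). apply (continuous_mult (fun r => r) ln).
    + apply continuous_id.
    + now apply continuous_ln.
Qed.

Definition cmean (F : R -> R -> R) (x y r : R) : R :=
  / (2 * PI) * RInt (fun t => F (x + r * cos t) (y + r * sin t)) 0 (2 * PI).

Lemma cont_cmean {X : UniformSpace} F (e1 e2 e3 : X -> R) :
  cont2 F -> cont e1 -> cont e2 -> cont e3 -> cont (fun p => cmean F (e1 p) (e2 p) (e3 p)).
Proof.
  intros HF H1 H2 H3. apply (cont_mult (fun _ => / (2 * PI))); [apply cont_const | ].
  apply (cont_RInt (fun p t => F (e1 p + e3 p * cos t) (e2 p + e3 p * sin t))).
  { pose proof PI_RGT_0. lra. }
  assert (Hf : forall e : X -> R, cont e -> cont (fun q : X * R => e (fst q))).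
  { intros e He. apply (cont_comp fst e); [apply (cont_fst (fun q => q)), cont_id | exact He]. }
  assert (Hs : forall e : R -> R, cont e -> cont (fun q : X * R => e (snd q))).
  { intros e He. apply (cont_comp snd e); [apply (cont_snd (fun q => q)), cont_id | exact He]. }
  apply (cont2_comp F (fun q => e1 (fst q) + e3 (fst q) * cos (snd q))
                      (fun q => e2 (fst q) + e3 (fst q) * sin (snd q)) HF).
  - apply cont_plus; [now apply (Hf e1) | ].
    apply cont_mult; [now apply (Hf e3) | apply (Hs cos), cont_cos].
  - apply cont_plus; [now apply (Hf e2) | ].
    apply cont_mult; [now apply (Hf e3) | apply (Hs sin), cont_sin].
Qed.

(** Syntax-directed proof of [cont] and [cont2] goals; what it cannot decompose is left to the caller. *)
Ltac cont :=
  match goal with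
  | H : cont ?f |- cont ?f => exact H
  | |- cont2 _ => unfold cont2; cbv beta; cont
  | |- cont (fun x => x) => apply cont_id
  | |- cont fst => apply (cont_fst (fun p => p)); apply cont_id
  | |- cont snd => apply (cont_snd (fun p => p)); apply cont_id
  | |- cont (fun x => fst (@?f x)) => apply (cont_fst f); cont
  | |- cont (fun x => snd (@?f x)) => apply (cont_snd f); cont
  | |- cont (fun x => @?f x + @?g x) => apply (cont_plus f g); cont
  | |- cont (fun x => @?f x - @?g x) => apply (cont_minus f g); cont
  | |- cont (fun x => @?f x * @?g x) => apply (cont_mult f g); cont
  | |- cont (fun x => - @?f x) => apply (cont_opp f); cont
  | |- cont (fun x => sin (@?f x)) => apply (cont_comp f sin); [cont | apply cont_sin]
  | |- cont (fun x => cos (@?f x)) => apply (cont_comp f cos); [cont | apply cont_cos]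
  | |- cont (fun x => exp (@?f x)) => apply (cont_comp f exp); [cont | apply cont_exp]
  | |- cont (fun x => sqrt (@?f x)) => apply (cont_comp f sqrt); [cont | apply cont_sqrt]
  | |- cont (fun x => _ ^ _) => unfold pow; cont
  | H : cont2 ?f |- cont (fun x => ?f (@?e1 x) (@?e2 x)) =>
      apply (cont2_comp f e1 e2); [exact H | cont | cont]
  | H : cont ?f |- cont (fun x => ?f (@?e x)) =>
      apply (cont_comp e f); [cont | exact H]
  | |- cont (fun x => log_weight (@?f x)) => apply (cont_comp f log_weight); [cont | apply cont_log_weight]
  | |- cont (fun x => cmean ?F (@?e1 x) (@?e2 x) (@?e3 x)) =>
      apply (cont_cmean F e1 e2 e3); cont
  | |- cont (cmean ?F ?x ?y) => apply (cont_cmean F (fun _ => x) (fun _ => y) (fun r => r)); cont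
  | |- cont (fun x => RInt (@?h x) ?a ?b) =>
      apply (cont_RInt h a b); [first [lra | pose proof PI_RGT_0; lra] | cbv beta; cont]
  | |- cont (fun x => ?c) => exact (cont_const c)
  | _ => idtac
  end.

Lemma cont_RInt_upper (f : R -> R) a : cont f -> cont (fun x => RInt f a x).
Proof.
  intros Hf x. apply (ex_derive_continuous (fun x => RInt f a x)). exists (f x).
  apply (is_derive_RInt f (fun x => RInt f a x) a x); [ | apply Hf].
  apply filter_forall. intros y. apply (@RInt_correct R_CompleteNormedModule).
  now apply cont_ex_RInt.
Qed.

Lemma is_derive_RInt_cont (f : R -> R) a x : cont f ->
  is_derive (fun x => RInt f a x) x (f x).
Proof.
  intros Hf.
  apply (is_derive_RInt f (fun x => RInt f a x) a x); [ | apply Hf].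
  apply filter_forall. intros y. apply (@RInt_correct R_CompleteNormedModule).
  now apply cont_ex_RInt.
Qed.

Lemma RInt_of_derive (f df : R -> R) a b : a <= b ->
  (forall x, a <= x <= b -> is_derive f x (df x)) -> cont df ->
  RInt df a b = f b - f a.
Proof.
  intros Hab Hd Hc. apply is_RInt_unique. apply (is_RInt_derive f df).
  - intros x Hx. rewrite Rmin_left, Rmax_right in Hx by trivial. now apply Hd.
  - intros x _. apply Hc.
Qed.

Lemma is_derive_RInt_slice (h h' : R -> R -> R) a b x :
  a <= b -> cont2 h -> cont2 h' ->
  locally x (fun u => forall t, is_derive (fun s => h s t) u (h' u t)) ->
  is_derive (fun u => RInt (h u) a b) x (RInt (h' x) a b).
Proof.
  intros Hab H H' Hd.
  replace (RInt (h' x) a b) with (RInt (fun t => Derive (fun u => h u t) x) a b).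
  2: { apply RInt_ext. intros t _. apply is_derive_unique.
       now apply (locally_singleton _ _ Hd). }
  apply (is_derive_RInt_param h).
  - apply Hierarchy.filter_imp with (2 := Hd). intros u Hu t _. eexists; apply Hu.
  - intros t _. apply continuity_2d_pt_ext_loc with h'; [ | now apply cont2_continuity_2d].
    destruct Hd as [d Hd]. exists d. intros u v Hu Hv. symmetry. apply is_derive_unique.
    now apply Hd.
  - apply filter_forall. intros u. apply cont_ex_RInt. now apply (cont_slice h).
Qed.

(** Fubini.  Both sides, as functions of the upper bound [b], have the same
    derivative. *)
Lemma RInt_swap_order (h : R -> R -> R) a b c d : a <= b -> c <= d -> cont2 h ->
  RInt (fun x => RInt (h x) c d) a b = RInt (fun y => RInt (fun x => h x y) a b) c d.
Proof.
  intros Hab Hcd H.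
  assert (Cr : cont2 (fun x y => RInt (fun s => h s y) a x)).
  { apply cont_ext with (fun p : R * R =>
      RInt (fun t => (fst p - a) * h ((fst p - a) * t + a) (snd p)) 0 1).
    - intros [x y]; simpl.
      rewrite (RInt_Rcomp_lin (fun s => h s y)) by cont. f_equal; ring.
    - apply (cont_RInt (fun (p : R * R) t => (fst p - a) * h ((fst p - a) * t + a) (snd p)) 0 1); [lra | cont]. }
  set (Psi := fun x => RInt (fun y => RInt (fun s => h s y) a x) c d).
  assert (E : RInt (fun x => RInt (h x) c d) a b = Psi b - Psi a).
  { apply (RInt_of_derive Psi); trivial.
    - intros x _. apply (is_derive_RInt_slice (fun x y => RInt (fun s => h s y) a x) h); trivial.
      apply filter_forall. intros u t. apply (is_derive_RInt_cont (fun s => h s t)). cont.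
    - now apply (cont_RInt h). }
  rewrite E.
  assert (Z : Psi a = 0).
  { transitivity (RInt (fun _ => 0) c d).
    - apply RInt_ext. intros y _. exact (RInt_point a (fun s => h s y)).
    - rewrite RInt_const. apply Rmult_0_r. }
  rewrite Z. apply Rminus_0_r.
Qed.

(** * Two-variable derivatives and log-polar coordinates *)

Lemma differentiable_pt_lim_eq f x y a b a' b' :
  differentiable_pt_lim f x y a b -> a = a' -> b = b' -> differentiable_pt_lim f x y a' b'.
Proof. now intros H <- <-. Qed.

Lemma differentiable_pt_lim_id1 x y : differentiable_pt_lim (fun u v => u) x y 1 0.
Proof. apply (differentiable_pt_lim_proj1_0 (fun u => u)). apply derivable_pt_lim_id. Qed.

Lemma differentiable_pt_lim_id2 x y : differentiable_pt_lim (fun u v => v) x y 0 1.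
Proof.
  intros eps. exists posreal_one. intros u v _ _.
  replace (v - y - (0 * (u - x) + 1 * (v - y))) with 0 by ring. rewrite Rabs_R0.
  apply Rmult_le_pos; [apply Rlt_le, cond_pos | ].
  apply Rle_trans with (2 := Rmax_l _ _). apply Rabs_pos.
Qed.

Lemma differentiable_pt_lim_plus f g x y a b c d :
  differentiable_pt_lim f x y a b -> differentiable_pt_lim g x y c d ->
  differentiable_pt_lim (fun u v => f u v + g u v) x y (a + c) (b + d).
Proof.
  intros Hf Hg. eapply differentiable_pt_lim_eq.
  - apply (differentiable_pt_lim_comp (fun u v => u + v) f g) with (l1x := 1) (l1y := 1) (2 := Hf) (3 := Hg).
    intros eps. exists posreal_one. intros u v _ _.
    match goal with |- Rabs ?e <= _ => replace e with 0 by ring end. rewrite Rabs_R0.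
    apply Rmult_le_pos; [apply Rlt_le, cond_pos | ].
    apply Rle_trans with (2 := Rmax_l _ _). apply Rabs_pos.
  - ring.
  - ring.
Qed.

Lemma differentiable_pt_lim_mult f g x y a b c d :
  differentiable_pt_lim f x y a b -> differentiable_pt_lim g x y c d ->
  differentiable_pt_lim (fun u v => f u v * g u v) x y
    (a * g x y + f x y * c) (b * g x y + f x y * d).
Proof.
  intros Hf Hg. eapply differentiable_pt_lim_eq.
  - apply (differentiable_pt_lim_comp (fun u v => u * v) f g)
      with (l1x := g x y) (l1y := f x y) (2 := Hf) (3 := Hg).
    intros eps. exists eps. intros u v Hu Hv.
    replace (u * v - f x y * g x y - (g x y * (u - f x y) + f x y * (v - g x y)))
      with ((u - f x y) * (v - g x y)) by ring.
    rewrite Rabs_mult. apply Rmult_le_compat; try apply Rabs_pos.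
    + now apply Rlt_le.
    + apply Rmax_r.
  - ring.
  - ring.
Qed.

Lemma differentiable_pt_lim_comp_1d (h : R -> R) f x y l a b :
  derivable_pt_lim h (f x y) l -> differentiable_pt_lim f x y a b ->
  differentiable_pt_lim (fun u v => h (f u v)) x y (l * a) (l * b).
Proof.
  intros Hh Hf. eapply differentiable_pt_lim_eq.
  - apply (differentiable_pt_lim_comp (fun u _ => h u) f f) with (2 := Hf) (3 := Hf).
    apply differentiable_pt_lim_proj1_0. exact Hh.
  - ring.
  - ring.
Qed.

Lemma differentiable_pt_lim_const c x y : differentiable_pt_lim (fun _ _ => c) x y 0 0.
Proof. apply (differentiable_pt_lim_proj1_0 (fun _ => c)). apply derivable_pt_lim_const. Qed.

Lemma differentiable_pt_lim_slice1 f x y a b :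
  differentiable_pt_lim f x y a b -> is_derive (fun s => f s y) x a.
Proof.
  intros H. apply is_derive_Reals. replace a with (a * 1 + b * 0) by ring.
  apply (derivable_pt_lim_comp_2d f (fun s => s) (fun _ => y)); trivial.
  - apply derivable_pt_lim_id.
  - apply derivable_pt_lim_const.
Qed.

Lemma differentiable_pt_lim_slice2 f x y a b :
  differentiable_pt_lim f x y a b -> is_derive (fun t => f x t) y b.
Proof.
  intros H. apply is_derive_Reals. replace b with (a * 0 + b * 1) by ring.
  apply (derivable_pt_lim_comp_2d f (fun _ => x) (fun t => t)); trivial.
  - apply derivable_pt_lim_const.
  - apply derivable_pt_lim_id.
Qed.

(** A function bundled with candidates for its derivatives of order at most two:
    [jxy] is the [y]-derivative of [jx], and [jyx] the [x]-derivative of [jy].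
    Keeping the candidates as data lets them be globally continuous even where
    the function is not differentiable. *)
Record jet := Jet {
  j0 : R -> R -> R; jx : R -> R -> R; jy : R -> R -> R;
  jxx : R -> R -> R; jxy : R -> R -> R; jyx : R -> R -> R; jyy : R -> R -> R }.

Definition jet_at (J : jet) (x y : R) : Prop :=
  differentiable_pt_lim (j0 J) x y (jx J x y) (jy J x y) /\
  differentiable_pt_lim (jx J) x y (jxx J x y) (jxy J x y) /\
  differentiable_pt_lim (jy J) x y (jyx J x y) (jyy J x y).

Definition jet_cont (J : jet) : Prop :=
  cont2 (j0 J) /\ cont2 (jx J) /\ cont2 (jy J) /\
  cont2 (jxx J) /\ cont2 (jxy J) /\ cont2 (jyx J) /\ cont2 (jyy J).

Definition lap (J : jet) (x y : R) : R := jxx J x y + jyy J x y.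

(** The chain rule for [(s, t) |-> (x0 + e^s cos t, y0 + e^s sin t)]. *)
Definition jet_logpolar (x0 y0 : R) (J : jet) : jet :=
  let pull f := fun s t : R => f (x0 + exp s * cos t) (y0 + exp s * sin t) in
  {| j0 := pull (j0 J);
     jx := fun s t => exp s * cos t * pull (jx J) s t + exp s * sin t * pull (jy J) s t;
     jy := fun s t => - (exp s * sin t) * pull (jx J) s t + exp s * cos t * pull (jy J) s t;
     jxx := fun s t =>
       exp s * cos t * pull (jx J) s t + exp s * sin t * pull (jy J) s t
       + exp s * cos t * (exp s * cos t * pull (jxx J) s t + exp s * sin t * pull (jxy J) s t)
       + exp s * sin t * (exp s * cos t * pull (jyx J) s t + exp s * sin t * pull (jyy J) s t);
     jxy := fun s t =>
       - (exp s * sin t) * pull (jx J) s t + exp s * cos t * pull (jy J) s t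
       + exp s * cos t * (- (exp s * sin t) * pull (jxx J) s t + exp s * cos t * pull (jxy J) s t)
       + exp s * sin t * (- (exp s * sin t) * pull (jyx J) s t + exp s * cos t * pull (jyy J) s t);
     jyx := fun s t =>
       - (exp s * sin t) * pull (jx J) s t + exp s * cos t * pull (jy J) s t
       - exp s * sin t * (exp s * cos t * pull (jxx J) s t + exp s * sin t * pull (jxy J) s t)
       + exp s * cos t * (exp s * cos t * pull (jyx J) s t + exp s * sin t * pull (jyy J) s t);
     jyy := fun s t =>
       - (exp s * cos t) * pull (jx J) s t - exp s * sin t * pull (jy J) s t
       - exp s * sin t * (- (exp s * sin t) * pull (jxx J) s t + exp s * cos t * pull (jxy J) s t)
       + exp s * cos t * (- (exp s * sin t) * pull (jyx J) s t + exp s * cos t * pull (jyy J) s t) |}.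

Lemma differentiable_pt_lim_expcos s t :
  differentiable_pt_lim (fun s t => exp s * cos t) s t (exp s * cos t) (- (exp s * sin t)).
Proof.
  eapply differentiable_pt_lim_eq.
  - apply (differentiable_pt_lim_mult (fun s _ => exp s) (fun _ t => cos t)).
    + apply (differentiable_pt_lim_comp_1d exp (fun s _ => s)); [apply derivable_pt_lim_exp | apply differentiable_pt_lim_id1].
    + apply (differentiable_pt_lim_comp_1d cos (fun _ t => t)); [apply derivable_pt_lim_cos | apply differentiable_pt_lim_id2].
  - ring.
  - ring.
Qed.

Lemma differentiable_pt_lim_expsin s t :
  differentiable_pt_lim (fun s t => exp s * sin t) s t (exp s * sin t) (exp s * cos t).
Proof.
  eapply differentiable_pt_lim_eq.
  - apply (differentiable_pt_lim_mult (fun s _ => exp s) (fun _ t => sin t)).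
    + apply (differentiable_pt_lim_comp_1d exp (fun s _ => s)); [apply derivable_pt_lim_exp | apply differentiable_pt_lim_id1].
    + apply (differentiable_pt_lim_comp_1d sin (fun _ t => t)); [apply derivable_pt_lim_sin | apply differentiable_pt_lim_id2].
  - ring.
  - ring.
Qed.

Lemma differentiable_pt_lim_pull x0 y0 f s t a b :
  differentiable_pt_lim f (x0 + exp s * cos t) (y0 + exp s * sin t) a b ->
  differentiable_pt_lim (fun s t => f (x0 + exp s * cos t) (y0 + exp s * sin t)) s t
    (exp s * cos t * a + exp s * sin t * b) (- (exp s * sin t) * a + exp s * cos t * b).
Proof.
  intros H. eapply differentiable_pt_lim_eq.
  - apply (differentiable_pt_lim_comp f (fun s t => x0 + exp s * cos t) (fun s t => y0 + exp s * sin t))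
      with (1 := H).
    + apply (differentiable_pt_lim_plus (fun _ _ => x0) _ _ _ _ _ _ _ (differentiable_pt_lim_const _ _ _) (differentiable_pt_lim_expcos _ _)).
    + apply (differentiable_pt_lim_plus (fun _ _ => y0) _ _ _ _ _ _ _ (differentiable_pt_lim_const _ _ _) (differentiable_pt_lim_expsin _ _)).
  - ring.
  - ring.
Qed.

Lemma jet_logpolar_at x0 y0 J s t :
  jet_at J (x0 + exp s * cos t) (y0 + exp s * sin t) -> jet_at (jet_logpolar x0 y0 J) s t.
Proof.
  intros [H0 [H1 H2]]. apply differentiable_pt_lim_pull in H0, H1, H2.
  split; [ | split]; unfold jet_logpolar; simpl.
  - exact H0.
  - eapply differentiable_pt_lim_eq.
    + apply (differentiable_pt_lim_plus _ _ _ _ _ _ _ _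
        (differentiable_pt_lim_mult _ _ _ _ _ _ _ _ (differentiable_pt_lim_expcos s t) H1) (differentiable_pt_lim_mult _ _ _ _ _ _ _ _ (differentiable_pt_lim_expsin s t) H2)).
    + simpl. ring.
    + simpl. ring.
  - eapply differentiable_pt_lim_eq.
    + apply (differentiable_pt_lim_plus (fun s t => - (exp s * sin t) * jx J (x0 + exp s * cos t) (y0 + exp s * sin t)) _ _ _ _ _ _ _
       (differentiable_pt_lim_mult _ _ _ _ _ _ _ _
          (differentiable_pt_lim_comp_1d Ropp _ _ _ _ _ _ (derivable_pt_lim_opp id _ _ (derivable_pt_lim_id _)) (differentiable_pt_lim_expsin s t)) H1)
       (differentiable_pt_lim_mult _ _ _ _ _ _ _ _ (differentiable_pt_lim_expcos s t) H2)).
    + simpl. ring.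
    + simpl. ring.
Qed.

(** The map is conformal with factor [e^s]; the mixed second derivatives cancel
    between the two summands. *)
Lemma lap_logpolar x0 y0 J s t :
  lap (jet_logpolar x0 y0 J) s t
  = exp s * exp s * lap J (x0 + exp s * cos t) (y0 + exp s * sin t).
Proof.
  unfold lap, jet_logpolar; simpl.
  set (X := x0 + _). set (Y := y0 + _).
  pose proof (sin2_cos2 t) as E. unfold Rsqr in E.
  replace (exp s * exp s * (jxx J X Y + jyy J X Y))
    with (exp s * exp s * (sin t * sin t + cos t * cos t) * (jxx J X Y + jyy J X Y))
    by (rewrite E; ring).
  ring.
Qed.

Lemma jet_logpolar_cont x0 y0 J : jet_cont J -> jet_cont (jet_logpolar x0 y0 J).
Proof.
  intros [H0 [Hx [Hy [Hxx [Hxy [Hyx Hyy]]]]]].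
  unfold jet_cont, jet_logpolar; simpl.
  repeat split; cont.
Qed.

Lemma is_derive_angular_mean J s0 s1 s :
  jet_cont J -> (forall s t, s0 < s < s1 -> jet_at J s t) ->
  s0 < s < s1 ->
  is_derive (fun s => RInt (j0 J s) 0 (2 * PI)) s (RInt (jx J s) 0 (2 * PI)).
Proof.
  intros [H0 [Hx [Hy [Hxx [Hxy [Hyx Hyy]]]]]] HJ Hs.
  apply is_derive_RInt_slice; trivial.
  { pose proof PI_RGT_0; lra. }
  assert (L : locally s (fun u => s0 < u < s1)).
  { apply (open_and _ _ (open_gt s0) (open_lt s1)). exact Hs. }
  apply Hierarchy.filter_imp with (2 := L). intros u Hu t.
  apply (differentiable_pt_lim_slice1 _ _ _ _ _ (proj1 (HJ u t Hu))).
Qed.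

(** The second [t]-derivative integrates to [0] over a period, so the second
    derivative of the mean is the mean of the Laplacian. *)
Lemma is_derive_angular_mean_2 J s0 s1 s :
  jet_cont J -> (forall s t, s0 < s < s1 -> jet_at J s t) ->
  (forall s, jy J s (2 * PI) = jy J s 0) ->
  s0 < s < s1 ->
  is_derive (fun s => RInt (jx J s) 0 (2 * PI)) s (RInt (lap J s) 0 (2 * PI)).
Proof.
  intros [H0 [Hx [Hy [Hxx [Hxy [Hyx Hyy]]]]]] HJ Hp Hs.
  assert (E : RInt (lap J s) 0 (2 * PI) = RInt (jxx J s) 0 (2 * PI)).
  { unfold lap. rewrite RInt_Rplus by (now apply cont_slice).
    rewrite <- Rplus_0_r. f_equal.
    rewrite (RInt_of_derive (fun t => jy J s t) (jyy J s)).
    - apply Rminus_diag_eq, Hp.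
    - pose proof PI_RGT_0; lra.
    - intros t _. apply (differentiable_pt_lim_slice2 _ _ _ _ _ (proj2 (proj2 (HJ s t Hs)))).
    - now apply cont_slice. }
  rewrite E. apply is_derive_RInt_slice; trivial.
  { pose proof PI_RGT_0; lra. }
  assert (L : locally s (fun u => s0 < u < s1)).
  { apply (open_and _ _ (open_gt s0) (open_lt s1)). exact Hs. }
  apply Hierarchy.filter_imp with (2 := L). intros u Hu t.
  apply (differentiable_pt_lim_slice1 _ _ _ _ _ (proj1 (proj2 (HJ u t Hu)))).
Qed.

(** * Circle means of superharmonic functions *)

Lemma nonincreasing_of_derive (f df : R -> R) a b : a <= b -> cont f ->
  (forall x, a < x < b -> is_derive f x (df x)) ->
  (forall x, a < x < b -> df x <= 0) -> f b <= f a.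
Proof.
  intros Hab Hf Hd Hs.
  (* [MVT_gen] may return an end point, where nothing is known of [df]. *)
  set (d := fun x => if excluded_middle_informative (a < x < b) then df x else 0).
  destruct (MVT_gen f a b d) as [c [_ E]].
  - rewrite Rmin_left, Rmax_right by trivial. intros x Hx. unfold d.
    destruct (excluded_middle_informative (a < x < b)); [now apply Hd | contradiction].
  - intros x _. apply continuity_pt_filterlim, Hf.
  - assert (d c <= 0).
    { unfold d. destruct (excluded_middle_informative (a < c < b)); [now apply Hs | lra]. }
    nra.
Qed.

(** The end points are excluded because the circle means below are only known to
    be differentiable at positive radii. *)
Lemma RInt_of_derive_open (f df : R -> R) a b : a <= b -> cont f -> cont df ->
  (forall x, a < x < b -> is_derive f x (df x)) ->
  RInt df a b = f b - f a.
Proof.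
  intros Hab Hf Hdf Hd.
  assert (HI : forall x, is_derive (fun x => RInt df a x) x (df x)).
  { intros x. now apply is_derive_RInt_cont. }
  assert (CI := cont_RInt_upper df a Hdf).
  assert (Ha : RInt df a a = 0) by exact (RInt_point a df).
  assert (H1 : f b - RInt df a b <= f a - RInt df a a).
  { apply (nonincreasing_of_derive (fun x => f x - RInt df a x) (fun x => df x - df x)); trivial.
    - now apply cont_minus.
    - intros x Hx. apply (is_derive_minus f (fun x => RInt df a x)); auto.
    - intros; lra. }
  assert (H2 : RInt df a b - f b <= RInt df a a - f a).
  { apply (nonincreasing_of_derive (fun x => RInt df a x - f x) (fun x => df x - df x)); trivial.
    - now apply cont_minus.
    - intros x Hx. apply (is_derive_minus (fun x => RInt df a x) f); auto.
    - intros; lra. }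
  rewrite Ha in H1, H2. lra.
Qed.

Definition mass (F : R -> R -> R) (x y : R) : R :=
  RInt (fun r => r * cmean F x y r) 0 1.

Definition logpot (F : R -> R -> R) (x y : R) : R :=
  RInt (fun r => log_weight r * cmean F x y r) 0 1.

Section CircleMeans.

Variables (J : jet) (F : R -> R -> R) (x y : R).
Hypothesis HJ : jet_cont J.
Hypothesis HF : cont2 F.
Hypothesis HJF : forall x' y', x - 2 < x' -> jet_at J x' y' /\ lap J x' y' = - F x' y'.

Let M (r : R) : R := RInt (fun t => j0 J (x + r * cos t) (y + r * sin t)) 0 (2 * PI).
Let B (r : R) : R :=
  RInt (fun t => cos t * jx J (x + r * cos t) (y + r * sin t)
               + sin t * jy J (x + r * cos t) (y + r * sin t)) 0 (2 * PI).
Let A (r : R) : R := RInt (fun t => F (x + r * cos t) (y + r * sin t)) 0 (2 * PI).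

Local Lemma cont_M : cont M.
Proof. destruct HJ as [H0 _]. unfold M. cont. Qed.

Local Lemma cont_B : cont B.
Proof. destruct HJ as [H0 [H1 [H2 _]]]. unfold B. cont. Qed.

Local Lemma cont_A : cont A.
Proof. unfold A. cont. Qed.

Let W := jet_logpolar x y J.

Local Lemma W_at s t : s < ln 2 -> jet_at W s t.
Proof.
  intros Hs. apply jet_logpolar_at, HJF.
  assert (exp s < 2) by (rewrite <- (exp_ln 2) by lra; apply exp_increasing; lra).
  pose proof (exp_pos s). pose proof (COS_bound t). nra.
Qed.

Local Lemma RInt_jx_W r : 0 < r -> RInt (jx W (ln r)) 0 (2 * PI) = r * B r.
Proof.
  intros Hr. destruct HJ as [H0 [H1 [H2 _]]]. unfold B. rewrite <- RInt_Rmult by cont.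
  apply RInt_Rext. intros t. unfold W, jet_logpolar; simpl. rewrite exp_ln by apply Hr.
  ring.
Qed.

Local Lemma ln_lt_ln2 r : 0 < r < 2 -> ln r - 1 < ln r < ln 2.
Proof. intros Hr. assert (ln r < ln 2) by (apply ln_increasing; lra). lra. Qed.

Local Lemma is_derive_M r : 0 < r < 2 -> is_derive M r (B r).
Proof.
  intros Hr.
  assert (D : is_derive (fun s => RInt (j0 W s) 0 (2 * PI)) (ln r) (RInt (jx W (ln r)) 0 (2 * PI))).
  { apply (is_derive_angular_mean W (ln r - 1) (ln 2)); [now apply jet_logpolar_cont | | now apply ln_lt_ln2].
    intros s t Hs. now apply W_at. }
  pose proof (is_derive_comp _ _ _ _ _ D (is_derive_ln r (proj1 Hr))) as D'.
  rewrite (RInt_jx_W r (proj1 Hr)) in D'.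
  replace (B r) with (/ r * (r * B r)) by (field; lra).
  apply is_derive_ext_loc with (2 := D').
  apply Hierarchy.filter_imp with (2 := open_gt 0 r (proj1 Hr)). intros z Hz.
  unfold M, W, jet_logpolar; simpl. now rewrite exp_ln.
Qed.

Local Lemma is_derive_rB r : 0 < r < 2 -> is_derive (fun r => r * B r) r (- (r * A r)).
Proof.
  intros Hr.
  assert (D : is_derive (fun s => RInt (jx W s) 0 (2 * PI)) (ln r) (RInt (lap W (ln r)) 0 (2 * PI))).
  { apply (is_derive_angular_mean_2 W (ln r - 1) (ln 2));
      [now apply jet_logpolar_cont | | | now apply ln_lt_ln2].
    - intros s t Hs. now apply W_at.
    - intros s. unfold W, jet_logpolar; simpl. now rewrite sin_2PI, cos_2PI, sin_0, cos_0. }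
  pose proof (is_derive_comp _ _ _ _ _ D (is_derive_ln r (proj1 Hr))) as D'.
  replace (- (r * A r)) with (/ r * RInt (lap W (ln r)) 0 (2 * PI)).
  - apply is_derive_ext_loc with (2 := D').
    apply Hierarchy.filter_imp with (2 := open_gt 0 r (proj1 Hr)). intros z Hz.
    now apply RInt_jx_W.
  - transitivity (/ r * (- (r * r) * A r)); [ | field; lra].
    f_equal. unfold A. rewrite <- RInt_Rmult by cont.
    apply RInt_Rext. intros t. unfold W. rewrite lap_logpolar, exp_ln by lra.
    assert (Hx : x - 2 < x + r * cos t) by (pose proof (COS_bound t); nra).
    rewrite (proj2 (HJF _ (y + r * sin t) Hx)). ring.
Qed.

Lemma cmean_0 : cmean (j0 J) x y 0 = j0 J x y.
Proof.
  unfold cmean. rewrite (RInt_Rext _ (fun _ => j0 J x y)).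
  - rewrite RInt_const. change (/ (2 * PI) * ((2 * PI - 0) * j0 J x y) = j0 J x y).
    field. apply PI_neq0.
  - intros t. f_equal; ring.
Qed.

(** With [M r] the integral over the circle of radius [r], [M' = B] and
    [(r B)' = - r A], the function [M r - ln r * (r B)] has derivative
    [r ln r * A] and, at [0], the value of [M]: integrating from [0] to [1] gives
    the logarithmic potential of [F]. *)
Lemma circle_representation : j0 J x y = cmean (j0 J) x y 1 + logpot F x y.
Proof.
  pose proof PI_RGT_0.
  assert (E : RInt (fun r => - (log_weight r * A r)) 0 1 = (M 1 + log_weight 1 * B 1) - (M 0 + log_weight 0 * B 0)).
  { apply (RInt_of_derive_open (fun r => M r + log_weight r * B r)); [lra | | | ].
    - pose proof cont_M; pose proof cont_B; cont.
    - pose proof cont_A; cont.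
    - intros r Hr.
      apply (is_derive_ext_loc (fun r => M r + - ln r * (r * B r))).
      { apply filter_forall. intros z. unfold log_weight.
        change (@eq R (M z + - ln z * (z * B z)) (M z + - (z * ln z) * B z)). ring. }
      replace (- (log_weight r * A r)) with (B r + (- / r * (r * B r) + - ln r * (- (r * A r))))
        by (unfold log_weight; field; lra).
      apply (is_derive_plus M (fun r => - ln r * (r * B r))).
      + apply is_derive_M; lra.
      + apply (Derive.is_derive_mult (fun r => - ln r) (fun r => r * B r)).
        * apply (is_derive_opp ln r (/ r)). apply is_derive_ln; lra.
        * apply is_derive_rB; lra. }
  rewrite log_weight_0 in E. unfold log_weight at 2 in E. rewrite ln_1 in E.
  rewrite <- cmean_0. unfold logpot.
  rewrite (RInt_Rext _ (fun r => - / (2 * PI) * (- (log_weight r * A r)))).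
  2: { intros r. unfold cmean. fold (A r). field. lra. }
  rewrite RInt_Rmult by (pose proof cont_A; cont).
  rewrite E. unfold cmean. fold (M 0) (M 1). field. lra.
Qed.

(** [r B] has nonpositive derivative and vanishes at [0], so [M' = B <= 0]. *)
Lemma cmean_nonincreasing r :
  (forall x' y', 0 <= F x' y') -> 0 <= r <= 1 -> cmean (j0 J) x y 1 <= cmean (j0 J) x y r.
Proof.
  intros HF0 Hr. pose proof PI_RGT_0.
  assert (HA : forall r, 0 <= A r) by (intros z; apply RInt_nonneg; [lra | cont | intros; apply HF0]).
  assert (HB : forall z, 0 < z < 2 -> z * B z <= 0).
  { intros z Hz. rewrite <- (Rmult_0_l (B 0)).
    apply (nonincreasing_of_derive (fun r => r * B r) (fun r => - (r * A r))); [lra | | | ].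
    - pose proof cont_B; cont.
    - intros w Hw. apply is_derive_rB; lra.
    - intros w Hw. pose proof (HA w). nra. }
  unfold cmean. apply Rmult_le_compat_l.
  { apply Rlt_le, Rinv_0_lt_compat; lra. }
  apply (nonincreasing_of_derive M B); [lra | apply cont_M | | ].
  - intros z Hz. apply is_derive_M; lra.
  - intros z Hz. pose proof (HB z). nra.
Qed.

End CircleMeans.

(** * From discs to squares *)

Lemma RInt_Rchasles (f : R -> R) a b c : cont f -> RInt f a b + RInt f b c = RInt f a c.
Proof. intros Hf. apply (RInt_Chasles f); now apply cont_ex_RInt. Qed.

Lemma RInt_shift (f : R -> R) c a b : cont f ->
  RInt (fun t => f (t + c)) a b = RInt f (a + c) (b + c).
Proof.
  intros Hf. rewrite <- (Rmult_1_l a) at 2. rewrite <- (Rmult_1_l b) at 2.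
  rewrite <- RInt_Rcomp_lin by trivial.
  apply RInt_Rext. intros x. now rewrite !Rmult_1_l.
Qed.

Lemma RInt_reflect (f : R -> R) a b : cont f ->
  RInt (fun t => f (- t)) (- b) (- a) = RInt f a b.
Proof.
  intros Hf.
  pose proof (RInt_Rcomp_lin f (-1) 0 (- b) (- a) Hf) as E.
  replace (-1 * - b + 0) with b in E by ring. replace (-1 * - a + 0) with a in E by ring.
  pose proof (RInt_Rchasles f a b a Hf) as E1. pose proof (RInt_point a f : RInt f a a = 0) as E2.
  rewrite (RInt_Rext _ (fun t => -1 * f (- t))) in E.
  - rewrite RInt_Rmult in E by cont. lra.
  - intros t. do 2 f_equal. ring.
Qed.

Lemma RInt_periodic (f : R -> R) a : cont f -> (forall t, f (t + 2 * PI) = f t) ->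
  RInt f a (a + 2 * PI) = RInt f 0 (2 * PI).
Proof.
  intros Hf Hp.
  assert (E : RInt f (2 * PI) (a + 2 * PI) = RInt f 0 a).
  { rewrite <- (Rplus_0_l (2 * PI)) at 1. rewrite <- RInt_shift by trivial.
    apply RInt_Rext. intros t. now rewrite Hp. }
  pose proof (RInt_Rchasles f a 0 (2 * PI) Hf). pose proof (RInt_Rchasles f a (2 * PI) (a + 2 * PI) Hf).
  pose proof (RInt_Rchasles f a 0 a Hf). pose proof (RInt_point a f : RInt f a a = 0). lra.
Qed.

Lemma RInt_le_larger (f : R -> R) a b c d : cont f -> (forall t, 0 <= f t) -> a <= b -> b <= c -> c <= d ->
  RInt f b c <= RInt f a d.
Proof.
  intros Hf H0 Hab Hbc Hcd.
  rewrite <- (RInt_Rchasles f a b d), <- (RInt_Rchasles f b c d) by trivial.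
  pose proof (RInt_nonneg f a b Hab Hf (fun t _ => H0 t)).
  pose proof (RInt_nonneg f c d Hcd Hf (fun t _ => H0 t)). lra.
Qed.

Lemma cos_plus_2PI t : cos (t + 2 * PI) = cos t.
Proof. rewrite <- (cos_period t 1). f_equal. simpl. ring. Qed.

Lemma sin_plus_2PI t : sin (t + 2 * PI) = sin t.
Proof. rewrite <- (sin_period t 1). f_equal. simpl. ring. Qed.

Definition sq (h : R -> R -> R) : R := RInt (fun x => RInt (h x) (-1) 1) (-1) 1.

Lemma sq_rotate h : cont2 h -> sq (fun x y => h (- y) x) = sq h.
Proof.
  intros Hh. unfold sq.
  rewrite (RInt_swap_order (fun x y => h (- y) x)) by (lra || cont).
  assert (C : cont (fun x => RInt (h x) (-1) 1)) by now apply (cont_RInt h); [lra | ].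
  transitivity (RInt (fun t => RInt (h (- t)) (-1) 1) (- (1)) (- (-1))).
  - f_equal; lra.
  - apply (RInt_reflect (fun x => RInt (h x) (-1) 1) (-1) 1 C).
Qed.

Lemma cos_atan_pos m : 0 < cos (atan m).
Proof. pose proof (atan_bound m). apply cos_gt_0; lra. Qed.

Lemma sin_atan_slope m : sin (atan m) = m * cos (atan m).
Proof.
  pose proof (cos_atan_pos m). rewrite <- (tan_atan m) at 2. unfold tan. field. lra.
Qed.

Lemma cont_atan : cont atan.
Proof.
  intros x. apply (ex_derive_continuous atan). exists (/ (1 + x ^ 2)).
  apply is_derive_Reals, derivable_pt_lim_atan.
Qed.

Lemma RInt_slope (f : R -> R) : cont f ->
  RInt f (- (PI / 4)) (PI / 4) = RInt (fun m => cos (atan m) * cos (atan m) * f (atan m)) (-1) 1.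
Proof.
  intros Hf. pose proof cont_atan as Ca.
  rewrite <- atan_1, <- atan_opp.
  assert (E : RInt (fun m => cos (atan m) * cos (atan m) * f (atan m)) (-1) 1 = RInt f (atan (-1)) (atan 1)).
  { apply (RInt_comp f atan (fun m => cos (atan m) * cos (atan m))).
    - intros m _. apply Hf.
    - intros m _. split.
      + replace (cos (atan m) * cos (atan m)) with (/ (1 + m ^ 2)).
        * apply is_derive_Reals, derivable_pt_lim_atan.
        * pose proof (sin2_cos2 (atan m)) as E. unfold Rsqr in *. rewrite sin_atan_slope in E.
          apply Rmult_eq_reg_l with (1 + m ^ 2); [ | nra]. rewrite Rinv_r by nra. lra.
      + assert (C : cont (fun m => cos (atan m) * cos (atan m))) by cont. apply C. }
  rewrite E. reflexivity.
Qed.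

(** The slope [m = tan t] and the abscissa [x = r cos t] turn the sector
    [|t| <= PI / 4] into a part of the triangle [|m x| <= x <= 1].  Both changes
    of variable are one-dimensional: one with [r] fixed, the other with [m]
    fixed. *)
Lemma sector_le_square h : cont2 h -> (forall x y, 0 <= h x y) ->
  RInt (fun r => r * RInt (fun t => h (r * cos t) (r * sin t)) (- (PI / 4)) (PI / 4)) 0 1 <= sq h.
Proof.
  intros Hh H0. pose proof cont_atan as Ca.
  set (g := fun r m => r * (cos (atan m) * cos (atan m) * h (r * cos (atan m)) (r * (m * cos (atan m))))).
  assert (Cg : cont2 g) by (unfold g; cont).
  rewrite (RInt_Rext _ (fun r => RInt (g r) (-1) 1)).
  2: { intros r. rewrite RInt_slope by cont. rewrite <- RInt_Rmult by cont.
       apply RInt_Rext. intros m. unfold g. now rewrite sin_atan_slope. }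
  rewrite RInt_swap_order by (lra || trivial).
  apply Rle_trans with (RInt (fun m => RInt (fun x => x * h x (m * x)) 0 1) (-1) 1).
  { apply RInt_le_cont; [lra | unfold g; cont | cont | ]. intros m _.
    pose proof (cos_atan_pos m) as Hc. pose proof (COS_bound (atan m)) as Hb.
    set (c := cos (atan m)) in *.
    replace (RInt (fun r => g r m) 0 1) with (RInt (fun x => x * h x (m * x)) 0 c).
    - assert (Cx : cont (fun x => x * h x (m * x))) by cont.
      rewrite <- (RInt_Rchasles _ 0 c 1) by trivial.
      assert (0 <= RInt (fun x => x * h x (m * x)) c 1).
      { apply RInt_nonneg; trivial; [lra | ]. intros x Hx. apply Rmult_le_pos; [lra | apply H0]. }
      lra.
    - replace c with (c * 1 + 0) at 1 by ring. replace 0 with (c * 0 + 0) at 1 by ring.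
      rewrite <- (RInt_Rcomp_lin (fun x => x * h x (m * x)) c 0 0 1) by cont.
      apply RInt_Rext. intros r. unfold g. fold c.
      replace (c * r + 0) with (r * c) by ring. replace (m * (r * c)) with (r * (m * c)) by ring. ring. }
  rewrite (RInt_swap_order (fun m x => x * h x (m * x))) by (lra || cont).
  assert (Ch : cont (fun x => RInt (h x) (-1) 1)) by now apply (cont_RInt h); [lra | ].
  apply Rle_trans with (RInt (fun x => RInt (h x) (-1) 1) 0 1).
  - apply RInt_le_cont; [lra | cont | trivial | ]. intros x Hx.
    assert (Cx : cont (h x)) by now apply cont_slice.
    replace (RInt (fun m => x * h x (m * x)) (-1) 1) with (RInt (h x) (- x) x).
    + apply RInt_le_larger; trivial; lra.
    + replace (- x) with (x * -1 + 0) by ring. replace x with (x * 1 + 0) at 3 by ring.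
      rewrite <- (RInt_Rcomp_lin (h x) x 0 (-1) 1) by trivial.
      apply RInt_Rext. intros m. do 2 f_equal. ring.
  - apply RInt_le_larger; trivial; try lra. intros x. apply RInt_nonneg; trivial; [lra | now apply cont_slice].
Qed.

(** The disc is the union of four rotated copies of the sector above, and the
    mean divides the resulting factor [4] by [2 PI]. *)
Lemma mass_le_square F x y : cont2 F -> (forall x y, 0 <= F x y) ->
  mass F x y <= sq (fun s t => F (x + s) (y + t)).
Proof.
  intros HF H0. pose proof PI_RGT_0.
  set (h := fun s t => F (x + s) (y + t)).
  set (rot := fun (k : R -> R -> R) s t => k (- t) s).
  assert (Crot : forall k, cont2 k -> cont2 (rot k)) by (intros k Hk; unfold rot; cont).
  set (S := fun (k : R -> R -> R) r => RInt (fun t => k (r * cos t) (r * sin t)) (- (PI / 4)) (PI / 4)).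
  assert (CS : forall k, cont2 k -> cont (S k)).
  { intros k Hk. unfold S. cont. }
  assert (HS : forall k, cont2 k -> (forall x y, 0 <= k x y) -> RInt (fun r => r * S k r) 0 1 <= sq k).
  { intros k Hk Hk0. now apply sector_le_square. }
  assert (Ch : cont2 h) by (unfold h; cont).
  assert (C1 := Crot _ Ch). assert (C2 := Crot _ C1). assert (C3 := Crot _ C2).
  assert (P0 : forall x y, 0 <= h x y) by (intros; apply H0).
  assert (Hrot : forall (k : R -> R -> R) r a, cont2 k ->
     RInt (fun t => k (r * cos t) (r * sin t)) (a + PI / 2) (a + PI / 2 + PI / 2)
     = RInt (fun t => rot k (r * cos t) (r * sin t)) a (a + PI / 2)).
  { intros k r a Hk. rewrite <- RInt_shift by cont. apply RInt_Rext. intros t. unfold rot.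
    replace (t + PI / 2) with (PI / 2 + t) by ring. rewrite <- cos_sin.
    replace (cos (PI / 2 + t)) with (- sin t).
    - f_equal. ring.
    - rewrite sin_cos. ring. }
  assert (E : forall r, cmean F x y r
     = / (2 * PI) * (S h r + S (rot h) r + S (rot (rot h)) r + S (rot (rot (rot h))) r)).
  { intros r. unfold cmean. f_equal.
    set (q := fun (k : R -> R -> R) b => RInt (fun t => k (r * cos t) (r * sin t)) b (b + PI / 2)).
    set (a := - (PI / 4)).
    assert (Sq : forall k, S k r = q k a).
    { intros k. unfold S, q, a. f_equal. field. }
    assert (Hq : forall k b, cont2 k -> q (rot k) b = q k (b + PI / 2)).
    { intros k b Hk. symmetry. now apply Hrot. }
    rewrite !Sq, (Hq _ a C2), (Hq _ _ C1), (Hq _ _ Ch), (Hq _ _ C1), (Hq _ _ Ch), (Hq _ _ Ch).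
    set (f := fun t => h (r * cos t) (r * sin t)).
    assert (Cf : cont f) by (unfold f; cont).
    assert (Ef : forall b, q h b = RInt f b (b + PI / 2)) by reflexivity.
    rewrite !Ef. change (RInt (fun t => F (x + r * cos t) (y + r * sin t)) 0 (2 * PI)) with (RInt f 0 (2 * PI)).
    rewrite <- (RInt_periodic f a); trivial.
    2: { intros t. unfold f. now rewrite cos_plus_2PI, sin_plus_2PI. }
    replace (a + 2 * PI) with (a + PI / 2 + PI / 2 + PI / 2 + PI / 2) by field.
    rewrite !RInt_Rchasles by trivial. reflexivity. }
  unfold mass.
  rewrite (RInt_Rext _ (fun r => / (2 * PI) * (r * S h r + r * S (rot h) r + r * S (rot (rot h)) r
     + r * S (rot (rot (rot h))) r))) by (intros r; rewrite E; ring).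
  assert (CC : forall k, cont2 k -> cont (fun r => r * S k r)).
  { intros k Hk. specialize (CS k Hk). cont. }
  pose proof (CC _ Ch). pose proof (CC _ C1). pose proof (CC _ C2). pose proof (CC _ C3).
  rewrite RInt_Rmult by (repeat apply cont_plus; trivial).
  rewrite !RInt_Rplus by (repeat apply cont_plus; trivial).
  pose proof (HS _ Ch P0). pose proof (HS (rot h) C1 (fun s t => P0 (- t) s)).
  pose proof (HS (rot (rot h)) C2 (fun s t => P0 (- s) (- t))). pose proof (HS (rot (rot (rot h))) C3 (fun s t => P0 (- - t) (- s))).
  assert (E1 : sq (rot h) = sq h) by now apply sq_rotate.
  assert (E2 : sq (rot (rot h)) = sq h) by (rewrite <- E1; now apply sq_rotate).
  assert (E3 : sq (rot (rot (rot h))) = sq h) by (rewrite <- E2; now apply sq_rotate).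
  fold h.
  assert (Hsq : 0 <= sq h).
  { unfold sq. apply RInt_nonneg; [lra | | ].
    - apply (cont_RInt h); [lra | trivial].
    - intros s _. apply RInt_nonneg; [lra | now apply cont_slice | intros; apply P0]. }
  pose proof PI2_3_2 as Hpi.
  apply Rle_trans with (/ (2 * PI) * (4 * sq h)).
  - apply Rmult_le_compat_l; [apply Rlt_le, Rinv_0_lt_compat; lra | lra].
  - apply Rmult_le_reg_l with (2 * PI); [lra | ]. rewrite <- Rmult_assoc, Rinv_r by lra. nra.
Qed.

(** * Superharmonic functions on a half cylinder *)

Definition periodic2 (h : R -> R -> R) : Prop := forall x y, h x (y + 2 * PI) = h x y.

(** A side of length [2] is shorter than a period. *)
Lemma square_le_strip h x y : cont2 h -> (forall x y, 0 <= h x y) -> periodic2 h ->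
  sq (fun s t => h (x + s) (y + t)) <= RInt (fun s => RInt (h s) 0 (2 * PI)) (x - 1) (x + 1).
Proof.
  intros Hh H0 Hp. pose proof PI_RGT_0. pose proof PI2_3_2.
  assert (C : cont (fun s => RInt (h s) 0 (2 * PI))) by (apply (cont_RInt h); [lra | trivial]).
  replace (x - 1) with (-1 + x) by ring. replace (x + 1) with (1 + x) by ring.
  rewrite <- RInt_shift by trivial. unfold sq.
  apply RInt_le_cont; [lra | cont | | ].
  { apply (cont_comp (fun s => s + x) (fun s => RInt (h s) 0 (2 * PI))); [cont | trivial]. }
  intros s _. replace (x + s) with (s + x) by ring.
  assert (Cs : cont (h (s + x))) by now apply cont_slice.
  rewrite (RInt_Rext _ (fun t => h (s + x) (t + y))) by (intros t; f_equal; ring).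
  rewrite RInt_shift by trivial.
  rewrite <- (RInt_periodic (h (s + x)) (-1 + y)) by (trivial; apply Hp).
  apply RInt_le_larger; trivial; lra.
Qed.

Lemma nonincreasing_Cauchy (g : R -> R) t1 :
  (forall s, t1 <= s -> 0 <= g s) -> (forall s s', t1 <= s <= s' -> g s' <= g s) ->
  forall eps, 0 < eps -> exists T, t1 <= T /\ forall s s', T <= s -> T <= s' -> g s - g s' <= eps.
Proof.
  intros H0 Hm eps Heps.
  destruct (completeness (fun z => exists s, t1 <= s /\ z = - g s)) as [l [Hub Hl]].
  - exists 0. intros z [s [Hs ->]]. pose proof (H0 s Hs). lra.
  - exists (- g t1), t1. split; [lra | trivial].
  - assert (HT : exists T, t1 <= T /\ l - eps < - g T).
    { apply NNPP. intros Hn. assert (l <= l - eps); [ | lra].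
      apply Hl. intros z [s [Hs ->]]. apply Rnot_lt_le. intros Hlt. apply Hn. now exists s. }
    destruct HT as [T [HT1 HT2]]. exists T. split; trivial. intros s s' Hs Hs'.
    assert (g s <= g T) by (apply Hm; lra).
    assert (- g s' <= l) by (apply Hub; exists s'; split; [lra | trivial]). lra.
Qed.

Definition vanishing_mass (F : R -> R -> R) : Prop :=
  forall eps, 0 < eps -> exists T, forall x y, T <= x -> mass F x y <= eps.

(** The equation is only required for [x > t0], whereas continuity, positivity
    and periodicity hold everywhere: below [t0] the functions are meant to be
    frozen at their values on the boundary. *)
Record cylinder_superharmonic (J : jet) (F : R -> R -> R) (t0 : R) : Prop := {
  cs_cont : jet_cont J;
  cs_cont_F : cont2 F;
  cs_equation : forall x y, t0 < x -> jet_at J x y /\ lap J x y = - F x y;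
  cs_nonneg : forall x y, 0 <= j0 J x y;
  cs_nonneg_F : forall x y, 0 <= F x y;
  cs_periodic : periodic2 (j0 J);
  cs_periodic_jy : periodic2 (jy J);
  cs_periodic_F : periodic2 F }.

Section HalfCylinder.

Variables (J : jet) (F : R -> R -> R) (t0 : R).
Hypothesis HJF : cylinder_superharmonic J F t0.

Let HJ := cs_cont _ _ _ HJF.
Let HF := cs_cont_F _ _ _ HJF.
Let Heq := cs_equation _ _ _ HJF.
Let HJ0 := cs_nonneg _ _ _ HJF.
Let HF0 := cs_nonneg_F _ _ _ HJF.
Let HJp := cs_periodic _ _ _ HJF.
Let HJyp := cs_periodic_jy _ _ _ HJF.
Let HFp := cs_periodic_F _ _ _ HJF.

Let m (s : R) : R := RInt (j0 J s) 0 (2 * PI).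
Let m1 (s : R) : R := RInt (jx J s) 0 (2 * PI).
Let f (s : R) : R := RInt (F s) 0 (2 * PI).

Local Lemma two_pi_pos : 0 <= 2 * PI.
Proof. pose proof PI_RGT_0. lra. Qed.

Local Lemma cont_m : cont m.
Proof. apply (cont_RInt (j0 J) 0 (2 * PI) two_pi_pos). apply HJ. Qed.

Local Lemma cont_m1 : cont m1.
Proof. apply (cont_RInt (jx J) 0 (2 * PI) two_pi_pos). apply HJ. Qed.

Local Lemma cont_f : cont f.
Proof. now apply (cont_RInt F 0 (2 * PI) two_pi_pos). Qed.

Local Lemma f_nonneg s : 0 <= f s.
Proof. apply RInt_nonneg; [apply two_pi_pos | now apply cont_slice | intros; apply HF0]. Qed.

Local Lemma is_derive_m s : t0 < s -> is_derive m s (m1 s).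
Proof.
  intros Hs. apply (is_derive_angular_mean J t0 (s + 1)); [trivial | | lra].
  intros z t Hz. now apply Heq.
Qed.

Local Lemma is_derive_m1 s : t0 < s -> is_derive m1 s (- f s).
Proof.
  intros Hs. assert (E : - f s = RInt (lap J s) 0 (2 * PI)).
  { unfold f. rewrite (RInt_Rext (lap J s) (fun t => -1 * F s t)).
    - rewrite RInt_Rmult by now apply cont_slice. ring.
    - intros t. rewrite (proj2 (Heq s t Hs)). ring. }
  rewrite E. apply (is_derive_angular_mean_2 J t0 (s + 1)); trivial; [ | | lra].
  - intros z t Hz. now apply Heq.
  - intros z. rewrite <- (HJyp z 0). f_equal. ring.
Qed.

Local Lemma m1_nonincreasing s s' : t0 < s <= s' -> m1 s' <= m1 s.
Proof.
  intros Hs. apply (nonincreasing_of_derive m1 (fun s => - f s)); [lra | apply cont_m1 | | ].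
  - intros z Hz. apply is_derive_m1. lra.
  - intros z Hz. pose proof (f_nonneg z). lra.
Qed.

Local Lemma m_le_tangent s s' : t0 < s <= s' -> m s' <= m s + m1 s * (s' - s).
Proof.
  intros Hs.
  assert (m s' - m1 s * s' <= m s - m1 s * s); [ | lra].
  pose proof cont_m.
  apply (nonincreasing_of_derive (fun z => m z - m1 s * z) (fun z => m1 z - m1 s)); [lra | cont | | ].
  - intros z Hz. apply (is_derive_minus m (fun z => m1 s * z)).
    + apply is_derive_m; lra.
    + assert (Hl : is_derive (fun z => m1 s * z) z (m1 s * 1)) by apply is_derive_scal, (is_derive_id z).
      now rewrite Rmult_1_r in Hl.
  - intros z Hz. assert (m1 z <= m1 s) by (apply m1_nonincreasing; lra). lra.
Qed.

(** A concave function that is bounded below on a half line is nondecreasing. *)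
Local Lemma m1_nonneg s : t0 < s -> 0 <= m1 s.
Proof.
  intros Hs. apply Rnot_lt_le. intros Hneg.
  assert (Hm : forall z, 0 <= m z).
  { intros z. apply RInt_nonneg; [apply two_pi_pos | apply cont_slice, HJ | intros; apply HJ0]. }
  set (d := (m s + 1) / - m1 s).
  assert (Hd : 0 < d) by (apply Rdiv_lt_0_compat; [pose proof (Hm s) | ]; lra).
  assert (E : m1 s * d = - (m s + 1)) by (unfold d; field; lra).
  pose proof (m_le_tangent s (s + d) ltac:(lra)) as H.
  replace (s + d - s) with d in H by ring. pose proof (Hm (s + d)). lra.
Qed.

(** The mass of a strip is the drop of the slope [m1] across it, and [m1]
    decreases to a finite limit. *)
Lemma half_cylinder_mass : vanishing_mass F.
Proof.
  intros eps Heps.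
  destruct (nonincreasing_Cauchy m1 (t0 + 1)) with (eps := eps) as [T [HT HTc]]; trivial.
  - intros s Hs. apply m1_nonneg; lra.
  - intros s s' Hs. apply m1_nonincreasing; lra.
  - exists (T + 1). intros x y Hx.
    apply Rle_trans with (1 := mass_le_square F x y HF HF0).
    apply Rle_trans with (1 := square_le_strip F x y HF HF0 HFp).
    fold f. rewrite (RInt_Rext f (fun s => -1 * - f s)) by (intros s; ring).
    pose proof cont_f. rewrite RInt_Rmult by cont.
    rewrite (RInt_of_derive_open m1); [ | lra | apply cont_m1 | cont | ].
    + pose proof (HTc (x - 1) (x + 1)). lra.
    + intros s Hs. apply is_derive_m1. lra.
Qed.

(** The unit circle has the smallest mean among concentric circles of radius at
    most [1], so its mean is at most twice the integral over the disc, hence at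
    most a strip integral of the linearly growing [m]. *)
Lemma half_cylinder_bound : exists C T,
  0 <= C /\ forall x y, T <= x -> j0 J x y <= C * x + logpot F x y.
Proof.
  set (t1 := t0 + 1). pose proof (m1_nonneg t1 ltac:(unfold t1; lra)) as H1.
  assert (H0 : 0 <= m t1).
  { apply RInt_nonneg; [apply two_pi_pos | apply cont_slice, HJ | intros; apply HJ0]. }
  pose proof (Rabs_pos t1) as Ht1. pose proof (Rle_abs (- t1)) as Ht1'. rewrite Rabs_Ropp in Ht1'.
  exists (4 * (m t1 + m1 t1 * (2 + Rabs t1))), (Rmax 1 (t1 + 2)). split.
  { nra. }
  intros x y Hx. pose proof (Rmax_l 1 (t1 + 2)). pose proof (Rmax_r 1 (t1 + 2)).
  assert (HD : forall x' y', x - 2 < x' -> jet_at J x' y' /\ lap J x' y' = - F x' y').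
  { intros x' y' Hx'. apply Heq. unfold t1 in *; lra. }
  rewrite (circle_representation J F x y HJ HF HD). apply Rplus_le_compat_r.
  apply Rle_trans with (2 * mass (j0 J) x y).
  - assert (Cj : cont2 (j0 J)) by apply HJ. pose proof two_pi_pos.
    apply Rle_trans with (2 * RInt (fun r => r * cmean (j0 J) x y 1) 0 1).
    + rewrite (RInt_Rext _ (fun r => cmean (j0 J) x y 1 * r)) by (intros; ring).
      rewrite RInt_Rmult by cont.
      rewrite (RInt_of_derive (fun r => / 2 * r ^ 2) (fun r => r)); [ | lra | | cont ].
      * lra.
      * intros r _. replace r with (/ 2 * (INR 2 * 1 * r ^ pred 2)) at 2 by (simpl; field).
        apply is_derive_scal, is_derive_pow, (is_derive_id r).
    + apply Rmult_le_compat_l; [lra | ]. unfold mass. unfold cmean at 2.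
      apply RInt_le_cont; [lra | cont | cont | ]. intros r Hr.
      apply Rmult_le_compat_l; [lra | ]. apply (cmean_nonincreasing J F x y HJ HF HD r HF0 Hr).
  - pose proof (mass_le_square (j0 J) x y (proj1 HJ) HJ0) as A1.
    pose proof (square_le_strip (j0 J) x y (proj1 HJ) HJ0 HJp) as A2. fold m in A2.
    assert (A3 : RInt (fun s => m s) (x - 1) (x + 1)
       <= RInt (fun _ => m t1 + m1 t1 * (x + 1 + Rabs t1)) (x - 1) (x + 1)).
    { apply RInt_le_cont; [lra | apply cont_m | cont | ]. intros s Hs.
      pose proof (m_le_tangent t1 s ltac:(unfold t1 in *; lra)).
      assert (m1 t1 * (s - t1) <= m1 t1 * (x + 1 + Rabs t1)) by (apply Rmult_le_compat_l; lra). lra. }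
    rewrite RInt_const in A3.
    change (RInt m (x - 1) (x + 1) <= (x + 1 - (x - 1)) * (m t1 + m1 t1 * (x + 1 + Rabs t1))) in A3.
    assert (m t1 <= m t1 * x) by nra.
    assert (m1 t1 * (x + 1 + Rabs t1) <= m1 t1 * ((2 + Rabs t1) * x)) by (apply Rmult_le_compat_l; nra).
    lra.
Qed.

End HalfCylinder.

(** * Exponential integrability of logarithmic potentials *)

(** The potential with kernel [|z|^(-1/2)]: the weight is [r * r^(-1/2)]. *)
Definition sqrtpot (F : R -> R -> R) (x y : R) : R :=
  RInt (fun r => sqrt r * cmean F x y r) 0 1.

Lemma cmean_nonneg F x y r : cont2 F -> (forall t, 0 <= F (x + r * cos t) (y + r * sin t)) ->
  0 <= cmean F x y r.
Proof.
  intros HF H0. pose proof PI_RGT_0. apply Rmult_le_pos.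
  - apply Rlt_le, Rinv_0_lt_compat. lra.
  - apply RInt_nonneg; [lra | cont | intros; apply H0].
Qed.

Lemma cmean_le F G x y r : cont2 F -> cont2 G ->
  (forall t, F (x + r * cos t) (y + r * sin t) <= G (x + r * cos t) (y + r * sin t)) ->
  cmean F x y r <= cmean G x y r.
Proof.
  intros HF HG H. pose proof PI_RGT_0. apply Rmult_le_compat_l.
  - apply Rlt_le, Rinv_0_lt_compat. lra.
  - apply RInt_le_cont; [lra | cont | cont | intros; apply H].
Qed.

Lemma cmean_const c x y r : cmean (fun _ _ => c) x y r = c.
Proof.
  unfold cmean. rewrite RInt_const.
  change (/ (2 * PI) * ((2 * PI - 0) * c) = c). field. apply PI_neq0.
Qed.

Lemma cmean_affine F a b x y r : cont2 F ->
  cmean (fun p q => a + b * F p q) x y r = a + b * cmean F x y r.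
Proof.
  intros HF. pose proof (cmean_const a x y r) as E. unfold cmean in *.
  rewrite RInt_Rplus, RInt_Rmult, Rmult_plus_distr_l, E by cont. ring.
Qed.

Lemma cont_weighted_cmean (w : R -> R) F : cont w -> cont2 F ->
  cont2 (fun x y => RInt (fun r => w r * cmean F x y r) 0 1).
Proof.
  intros Hw HF.
  apply (cont_RInt (fun (p : R * R) r => w r * cmean F (fst p) (snd p) r)); [lra | ].
  cont.
Qed.

Lemma mass_nonneg F x y : cont2 F -> (forall x y, 0 <= F x y) -> 0 <= mass F x y.
Proof.
  intros HF H0. apply RInt_nonneg; [lra | | ].
  - cont.
  - intros r Hr. apply Rmult_le_pos; [lra | ]. now apply cmean_nonneg.
Qed.

Lemma logpot_le F x y L : cont2 F -> (forall x y, 0 <= F x y) ->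
  logpot F x y <= (L - 2) * mass F x y + 2 * exp (- (L / 2)) * sqrtpot F x y.
Proof.
  intros HF H0.
  assert (Cc : cont (cmean F x y)) by cont.
  unfold logpot, mass, sqrtpot. rewrite <- !RInt_Rmult, <- RInt_Rplus by cont.
  apply RInt_le_cont; [lra | cont | cont | ]. intros r Hr.
  pose proof (log_weight_le L r ltac:(lra)). pose proof (cmean_nonneg F x y r HF (fun _ => H0 _ _)).
  nra.
Qed.

(** Jensen's inequality for [exp] and the measure [2 r (cmean F x y r) dr] on
    [[0, 1]], completed to a probability by putting the missing mass at the value
    [0].  Since [exp (ln (1/r) / 2) = r^(-1/2)], the kernel of [sqrtpot] appears. *)
Lemma exp_logpot_le F x y : cont2 F -> (forall x y, 0 <= F x y) -> mass F x y <= / 2 ->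
  exp (logpot F x y) <= 1 + 2 * sqrtpot F x y.
Proof.
  intros HF H0 Hm. pose proof (mass_nonneg F x y HF H0) as Hm0.
  pose proof (logpot_le F x y (2 * logpot F x y) HF H0) as H.
  set (c := logpot F x y) in *. set (m := mass F x y) in *. set (S := sqrtpot F x y) in *.
  replace (2 * c / 2) with c in H by field.
  assert (He : exp c * exp (- c) = 1) by (rewrite <- exp_plus, Rplus_opp_r; apply exp_0).
  assert (Hc : exp c * (1 - c) <= 1).
  { rewrite <- He. apply Rmult_le_compat_l; [apply Rlt_le, exp_pos | ].
    pose proof (exp_ineq1_le (- c)). lra. }
  assert (H' : exp c * (c * (1 - 2 * m) + 2 * m) <= 2 * S).
  { replace (2 * S) with (exp c * (2 * exp (- c) * S))
      by (transitivity (2 * (exp c * exp (- c)) * S); [ | rewrite He]; ring).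
    apply Rmult_le_compat_l; [apply Rlt_le, exp_pos | lra]. }
  assert (exp c * (1 - c) * (1 - 2 * m) <= 1 * (1 - 2 * m)) by (apply Rmult_le_compat_r; lra).
  lra.
Qed.

Lemma cmean_weighted (w : R -> R) F x y r : cont w -> cont2 F ->
  cmean (fun p q => RInt (fun t => w t * cmean F p q t) 0 1) x y r
  = RInt (fun t => w t * cmean (fun p q => cmean F p q t) x y r) 0 1.
Proof.
  intros Hw HF. pose proof PI_RGT_0. unfold cmean at 1.
  assert (C : cont2 (fun a t => cmean F (x + r * cos a) (y + r * sin a) t)) by cont.
  rewrite (RInt_swap_order (fun a t => w t * cmean F (x + r * cos a) (y + r * sin a) t))
    by (lra || cont).
  rewrite <- RInt_Rmult.
  - apply RInt_Rext. intros t. rewrite RInt_Rmult by cont. unfold cmean at 2. ring.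
  - cont.
Qed.

Lemma cmean_comm F x y r t : cont2 F ->
  cmean (fun p q => cmean F p q t) x y r = cmean (fun p q => cmean F p q r) x y t.
Proof.
  intros HF. pose proof PI_RGT_0. unfold cmean.
  rewrite !RInt_Rmult by cont. do 2 f_equal.
  rewrite RInt_swap_order by (lra || cont).
  apply RInt_Rext. intros b. apply RInt_Rext. intros a. f_equal; ring.
Qed.

(** The iterated potential has the kernel [sqrt r * sqrt t <= (r + t) / 2]
    against the double mean [Phi r t].  Each of the two terms [r] and [t] leaves
    an average of masses of unit discs with centres in the unit disc, because
    [Phi] is symmetric. *)
Lemma sqrtpot_sqrtpot_le F x y mu : cont2 F -> (forall x y, 0 <= F x y) ->
  (forall x' y', x - 1 <= x' <= x + 1 -> mass F x' y' <= mu) ->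
  sqrtpot (sqrtpot F) x y <= mu.
Proof.
  intros HF H0 Hmu.
  set (Phi := fun r t => cmean (fun p q => cmean F p q t) x y r).
  assert (CPhi : cont2 Phi).
  { unfold Phi, cont2. unfold cmean at 1. pose proof PI_RGT_0.
    apply cont_mult; [cont | ].
    apply (cont_RInt (fun (p : R * R) a => cmean F (x + fst p * cos a) (y + fst p * sin a) (snd p))); [lra | ].
    cont. }
  assert (PPhi : forall r t, 0 <= Phi r t).
  { intros r t. apply (cmean_nonneg (fun p q => cmean F p q t) x y r); [cont | ].
    intros a. now apply cmean_nonneg. }
  assert (Ct : RInt (fun r => RInt (fun t => t * Phi r t) 0 1) 0 1 <= mu).
  { replace mu with (RInt (fun _ => mu) 0 1).
    2: { rewrite RInt_const. change ((1 - 0) * mu = mu). ring. }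
    apply RInt_le_cont; [lra | cont | cont | ]. intros r Hr.
    unfold Phi. rewrite <- (cmean_weighted (fun t => t)) by (trivial; cont).
    rewrite <- (cmean_const mu x y r).
    apply (cmean_le (mass F) (fun _ _ => mu)); [ | cont | ].
    - apply (cont_weighted_cmean (fun t => t)); trivial; cont.
    - intros a. apply Hmu. pose proof (COS_bound a). nra. }
  assert (Cr : RInt (fun r => RInt (fun t => r * Phi r t) 0 1) 0 1 <= mu).
  { rewrite (RInt_swap_order (fun r t => r * Phi r t)) by (lra || cont).
    apply Rle_trans with (2 := Ct). apply Req_le.
    apply RInt_Rext. intros t. apply RInt_Rext. intros r.
    now rewrite (cmean_comm F x y r t HF : Phi r t = Phi t r). }
  unfold sqrtpot at 1.
  rewrite (RInt_Rext _ (fun r => RInt (fun t => sqrt r * (sqrt t * Phi r t)) 0 1)).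
  2: { intros r. rewrite RInt_Rmult by cont. unfold Phi.
       rewrite <- (cmean_weighted sqrt F x y r cont_sqrt HF). reflexivity. }
  apply Rle_trans with (RInt (fun r => / 2 * (RInt (fun t => r * Phi r t) 0 1 + RInt (fun t => t * Phi r t) 0 1)) 0 1).
  - apply RInt_le_cont; [lra | cont | cont | ]. intros r Hr.
    rewrite <- RInt_Rplus, <- RInt_Rmult by cont.
    apply RInt_le_cont; [lra | cont | cont | ]. intros t Ht.
    pose proof (PPhi r t). pose proof (sqrt_sqrt r (proj1 Hr)). pose proof (sqrt_sqrt t (proj1 Ht)).
    assert (sqrt r * sqrt t <= / 2 * (r + t)) by (pose proof (pow2_ge_0 (sqrt r - sqrt t)); nra).
    nra.
  - rewrite RInt_Rmult, RInt_Rplus by cont. lra.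
Qed.

(** Exponentially large densities have small potentials: [L] is the cut-off in
    [logpot_le], and the short-range part [sqrtpot G] is bounded by [exp (L / 2)]
    times an iterated potential of [F], which is at most [1/2]. *)
Lemma logpot_le_of_exp F G x y L : cont2 F -> cont2 G ->
  (forall x y, 0 <= F x y) -> (forall x y, 0 <= G x y) ->
  (forall x' y', x - 1 <= x' <= x + 1 -> mass F x' y' <= / 2) ->
  (forall x' y', x - 1 <= x' <= x + 1 -> G x' y' <= exp (L / 2) * exp (logpot F x' y')) ->
  logpot G x y <= L * mass G x y + 4.
Proof.
  intros HF HG F0 G0 Hm HGF.
  assert (CS : cont2 (sqrtpot F)) by (apply (cont_weighted_cmean sqrt); trivial; apply cont_sqrt).
  assert (CcS : cont (cmean (sqrtpot F) x y)) by cont.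
  assert (CcG : cont (cmean G x y)) by cont.
  pose proof (exp_pos (L / 2)) as He.
  assert (HS : sqrtpot G x y <= 2 * exp (L / 2)).
  { apply Rle_trans with (RInt (fun r => exp (L / 2) * (1 + 2 * (sqrt r * cmean (sqrtpot F) x y r))) 0 1).
    - apply RInt_le_cont; [lra | cont | cont | ]. intros r Hr.
      apply Rle_trans with (sqrt r * (exp (L / 2) + (exp (L / 2) * 2) * cmean (sqrtpot F) x y r)).
      + apply Rmult_le_compat_l; [apply sqrt_pos | ].
        rewrite <- cmean_affine by trivial.
        apply (cmean_le G (fun p q => exp (L / 2) + exp (L / 2) * 2 * sqrtpot F p q)); [trivial | cont | ].
        intros t. assert (Hx : x - 1 <= x + r * cos t <= x + 1) by (pose proof (COS_bound t); nra).
        apply Rle_trans with (1 := HGF _ _ Hx).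
        pose proof (exp_logpot_le F _ _ HF F0 (Hm _ (y + r * sin t) Hx)). nra.
      + assert (sqrt r <= 1) by (rewrite <- sqrt_1; apply sqrt_le_1_alt; lra). nra.
    - rewrite RInt_Rmult, RInt_Rplus, RInt_Rmult by cont.
      rewrite RInt_const. change (scal (1 - 0) 1) with ((1 - 0) * 1).
      pose proof (sqrtpot_sqrtpot_le F x y (/ 2) HF F0 Hm) as H. unfold sqrtpot at 1 in H. nra. }
  pose proof (logpot_le G x y L HG G0) as H.
  pose proof (mass_nonneg G x y HG G0).
  assert (E : exp (- (L / 2)) * exp (L / 2) = 1).
  { rewrite <- exp_plus. replace (- (L / 2) + L / 2) with 0 by ring. apply exp_0. }
  pose proof (exp_pos (- (L / 2))).
  assert (exp (- (L / 2)) * sqrtpot G x y <= exp (- (L / 2)) * (2 * exp (L / 2)))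
    by (apply Rmult_le_compat_l; lra).
  nra.
Qed.

Lemma logpot_le_of_bound G x y L : cont2 G -> (forall x y, 0 <= G x y) ->
  (forall x' y', x - 1 <= x' <= x + 1 -> G x' y' <= exp (L / 2)) ->
  logpot G x y <= L * mass G x y + 4.
Proof.
  intros HG G0 HL.
  assert (Z : forall (w : R -> R) x' y', RInt (fun r => w r * cmean (fun _ _ => 0) x' y' r) 0 1 = 0).
  { intros w x' y'. rewrite (RInt_Rext _ (fun _ => 0)).
    - rewrite RInt_const. change ((1 - 0) * 0 = 0). ring.
    - intros r. rewrite cmean_const. ring. }
  apply (logpot_le_of_exp (fun _ _ => 0)); trivial.
  - cont.
  - intros; lra.
  - intros x' y' _. unfold mass. rewrite (Z (fun r => r)). lra.
  - intros x' y' Hx. unfold logpot. rewrite (Z log_weight), exp_0, Rmult_1_r. now apply HL.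
Qed.

(** * The system on a half cylinder *)

Lemma rpow_pos x p : 0 < x -> rpow x p = Rpower x p.
Proof. intros Hx. unfold rpow. destruct (Req_dec_T x 0); [lra | reflexivity]. Qed.

Lemma rpow_le x y p : 0 <= x <= y -> 0 < y -> 0 < p -> rpow x p <= Rpower y p.
Proof.
  intros Hxy Hy Hp. unfold rpow. destruct (Req_dec_T x 0) as [E | E].
  - apply Rlt_le, exp_pos.
  - apply Rle_Rpower_l; lra.
Qed.

Lemma exp_le_compat x y : x <= y -> exp x <= exp y.
Proof. intros [H | ->]; [now apply Rlt_le, exp_increasing | apply Rle_refl]. Qed.

(** First [Q] is bounded through [logpot G], using the bound of [P] by [logpot F];
    then this bound on [Q] makes [F] at most [exp (L / 2)] with
    [L = O (x + x^lam)], and the vanishing mass of [F] multiplies [L]. *)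
Lemma cylinder_system a b lam Ju F Jv G t0 : 0 < a -> 0 <= b -> 0 < lam ->
  cylinder_superharmonic Ju F t0 -> cylinder_superharmonic Jv G t0 ->
  (forall x y, t0 < x -> F x y <= exp (b * x) * exp (rpow (Rabs (j0 Jv x y - a * x)) lam)) ->
  (forall x y, t0 < x -> G x y <= exp (b * x) * exp (j0 Ju x y - a * x)) ->
  (exists C T, forall x y, T <= x -> j0 Jv x y <= C * x) /\
  (exists C, forall eps, 0 < eps ->
     exists T, forall x y, T <= x -> j0 Ju x y <= C * x + eps * Rpower x lam).
Proof.
  intros Ha Hb Hlam HU HV HFV HGU.
  destruct (half_cylinder_bound Ju F t0 HU) as [Cu [Tu [Cu0 Bu]]].
  destruct (half_cylinder_bound Jv G t0 HV) as [Cv [Tv [Cv0 Bv]]].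
  pose proof (half_cylinder_mass Ju F t0 HU) as MF.
  pose proof (half_cylinder_mass Jv G t0 HV) as MG.
  destruct HU as [HJu HF _ Pu F0 _ _ _]. destruct HV as [HJv HG _ Pv G0 _ _ _].
  destruct (MF (/ 2)) as [T1 HT1]; [lra | ].
  destruct (MG 1) as [T2 HT2]; [lra | ].
  set (C1 := Cv + 4 * (b + Cu) + 4).
  set (T3 := Rmax (Rmax (Tu + 1) (Rmax Tv (T1 + 1))) (Rmax T2 (Rmax 2 (t0 + 2)))).
  assert (HT3 : forall x, T3 <= x ->
     Tu + 1 <= x /\ Tv <= x /\ T1 + 1 <= x /\ T2 <= x /\ 2 <= x /\ t0 + 2 <= x).
  { intros x Hx. unfold T3 in Hx.
    pose proof (Rmax_l (Tu + 1) (Rmax Tv (T1 + 1))). pose proof (Rmax_r (Tu + 1) (Rmax Tv (T1 + 1))).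
    pose proof (Rmax_l Tv (T1 + 1)). pose proof (Rmax_r Tv (T1 + 1)).
    pose proof (Rmax_l T2 (Rmax 2 (t0 + 2))). pose proof (Rmax_r T2 (Rmax 2 (t0 + 2))).
    pose proof (Rmax_l 2 (t0 + 2)). pose proof (Rmax_r 2 (t0 + 2)).
    pose proof (Rmax_l (Rmax (Tu + 1) (Rmax Tv (T1 + 1))) (Rmax T2 (Rmax 2 (t0 + 2)))).
    pose proof (Rmax_r (Rmax (Tu + 1) (Rmax Tv (T1 + 1))) (Rmax T2 (Rmax 2 (t0 + 2)))).
    repeat split; lra. }
  clearbody T3.
  assert (HV1 : forall x y, T3 <= x -> j0 Jv x y <= C1 * x).
  { intros x y Hx. destruct (HT3 x Hx) as [X1 [X2 [X3 [X4 [X5 X6]]]]].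
    apply Rle_trans with (1 := Bv x y X2).
    assert (HL : logpot G x y <= (2 * ((b + Cu) * (x + 1))) * mass G x y + 4).
    { apply (logpot_le_of_exp F); trivial.
      - intros x' y' Hx'. apply HT1. lra.
      - intros x' y' Hx'. apply Rle_trans with (1 := HGU x' y' ltac:(lra)).
        rewrite <- !exp_plus. apply exp_le_compat.
        assert ((b + Cu) * x' <= (b + Cu) * (x + 1)) by (apply Rmult_le_compat_l; lra).
        pose proof (Bu x' y' ltac:(lra)). nra. }
    pose proof (HT2 x y X4). pose proof (mass_nonneg G x y HG G0).
    assert (0 <= (b + Cu) * (x + 1)) by (apply Rmult_le_pos; lra).
    assert ((2 * ((b + Cu) * (x + 1))) * mass G x y <= (2 * ((b + Cu) * (x + 1))) * 1)
      by (apply Rmult_le_compat_l; lra).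
    assert ((b + Cu) * (x + 1) <= (b + Cu) * (2 * x)) by (apply Rmult_le_compat_l; lra).
    unfold C1. lra. }
  split; [now exists C1, T3 | ].
  set (C2 := C1 + a). set (K := Rpower (2 * C2) lam).
  assert (HC2 : 0 < C2) by (unfold C2, C1; lra).
  assert (HK : 0 < K) by apply exp_pos.
  exists (Cu + 4 * b + 4). intros eps Heps.
  set (d := Rmin (/ 2) (eps / (2 * K))).
  assert (Hd : 0 < d) by (apply Rmin_pos; [lra | apply Rdiv_lt_0_compat; lra]).
  destruct (MF d Hd) as [T4 HT4].
  exists (Rmax (T3 + 1) T4). intros x y Hx.
  pose proof (Rmax_l (T3 + 1) T4). pose proof (Rmax_r (T3 + 1) T4).
  destruct (HT3 x ltac:(lra)) as [X1 [X2 [X3 [X4 [X5 X6]]]]].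
  set (P := Rpower x lam). assert (HP : 0 < P) by apply exp_pos.
  apply Rle_trans with (1 := Bu x y ltac:(lra)).
  assert (HL : logpot F x y <= (2 * (b * (2 * x) + K * P)) * mass F x y + 4).
  { apply logpot_le_of_bound; trivial.
    intros x' y' Hx'. apply Rle_trans with (1 := HFV x' y' ltac:(lra)).
    rewrite <- exp_plus. apply exp_le_compat.
    replace (2 * (b * (2 * x) + K * P) / 2) with (b * (2 * x) + K * P) by field.
    apply Rplus_le_compat; [apply Rmult_le_compat_l; lra | ].
    unfold K, P. rewrite Rpower_mult_distr by lra.
    apply rpow_le; [ | nra | trivial]. split; [apply Rabs_pos | ].
    pose proof (HV1 x' y' ltac:(lra)). pose proof (Pv x' y').
    assert (C2 * x' <= C2 * (2 * x)) by (apply Rmult_le_compat_l; lra).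
    assert (0 <= C1 * x') by (apply Rmult_le_pos; unfold C1; lra).
    assert (0 <= a * x') by (apply Rmult_le_pos; lra).
    apply Rabs_le. unfold C2 in *. lra. }
  assert (Hm : mass F x y <= d) by (apply HT4; lra).
  assert (Hd1 : d <= / 2) by apply Rmin_l.
  assert (Hd2 : K * d <= eps / 2).
  { apply Rle_trans with (K * (eps / (2 * K))).
    - apply Rmult_le_compat_l; [lra | apply Rmin_r].
    - apply Req_le. field. lra. }
  assert (0 <= b * (2 * x)) by (apply Rmult_le_pos; lra).
  assert (HA : b * (2 * x) * mass F x y <= b * (2 * x) * / 2) by (apply Rmult_le_compat_l; lra).
  assert (HB : K * mass F x y * P <= eps / 2 * P).
  { apply Rmult_le_compat_r; [lra | ].
    apply Rle_trans with (2 := Hd2). apply Rmult_le_compat_l; lra. }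
  assert (0 <= b * x) by (apply Rmult_le_pos; lra).
  lra.
Qed.

(** * From the plane to the half cylinder *)

Definition jet_of (u : R * R -> R) : jet :=
  let dx := fun s t => Derive (fun z => u (z, t)) s in
  let dy := fun s t => Derive (fun z => u (s, z)) t in
  {| j0 := fun s t => u (s, t);
     jx := dx;
     jy := dy;
     jxx := fun s t => Derive (fun z => dx z t) s;
     jxy := fun s t => Derive (fun z => dx s z) t;
     jyx := fun s t => Derive (fun z => dy z t) s;
     jyy := fun s t => Derive (fun z => dy s z) t |}.

Lemma laplacian_jet_of u y : laplacian u y = lap (jet_of u) (fst y) (snd y).
Proof. reflexivity. Qed.

Definition jet_cont_at (J : jet) (x y : R) : Prop :=
  continuity_2d_pt (jxx J) x y /\ continuity_2d_pt (jxy J) x y /\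
  continuity_2d_pt (jyx J) x y /\ continuity_2d_pt (jyy J) x y.

Lemma differentiable_pt_lim_of_C1 f fx fy x y :
  locally (x, y) (fun p => is_derive (fun z => f z (snd p)) (fst p) (fx (fst p) (snd p))) ->
  is_derive (fun z => f x z) y (fy x y) ->
  continuity_2d_pt fx x y ->
  differentiable_pt_lim f x y (fx x y) (fy x y).
Proof.
  intros Hx Hy Hc. apply filterdiff_differentiable_pt_lim.
  apply (is_derive_filterdiff f x y fx (fy x y)); trivial.
  now apply continuity_2d_pt_filterlim in Hc.
Qed.

Lemma differentiable_pt_lim_continuity f x y a b : differentiable_pt_lim f x y a b -> continuity_2d_pt f x y.
Proof. intros H. apply differentiable_continuity_pt. now exists a, b. Qed.

Lemma jet_of_at (D : R * R -> Prop) u x y : open D -> C2_on D u -> D (x, y) ->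
  jet_at (jet_of u) x y /\ jet_cont_at (jet_of u) x y.
Proof.
  intros HD Hu Hxy.
  assert (Hloc : locally (x, y) (fun p => ex_diff_n (fun s t => u (s, t)) 2 (fst p) (snd p))).
  { apply Hierarchy.filter_imp with (2 := HD _ Hxy). intros p Hp. apply (Hu p Hp). }
  destruct (Hu _ Hxy) as [C0 [Dx [Dy [[Cx [Dxx [Dxy [[Cxx _] [Cxy _]]]]] [Cy [Dyx [Dyy [[Cyx _] [Cyy _]]]]]]]]].
  simpl in *.
  split; [ | now repeat split].
  split; [ | split].
  - apply (differentiable_pt_lim_of_C1 _ (jx (jet_of u)) (jy (jet_of u))); trivial.
    + apply Hierarchy.filter_imp with (2 := Hloc). intros p Hp. apply Derive_correct, Hp.
    + now apply Derive_correct.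
  - apply (differentiable_pt_lim_of_C1 _ (jxx (jet_of u)) (jxy (jet_of u))); trivial.
    + apply Hierarchy.filter_imp with (2 := Hloc). intros p Hp. apply Derive_correct, Hp.
    + now apply Derive_correct.
  - apply (differentiable_pt_lim_of_C1 _ (jyx (jet_of u)) (jyy (jet_of u))); trivial.
    + apply Hierarchy.filter_imp with (2 := Hloc). intros p Hp. apply Derive_correct, Hp.
    + now apply Derive_correct.
Qed.

Lemma continuity_pull x0 y0 f s t :
  continuity_2d_pt f (x0 + exp s * cos t) (y0 + exp s * sin t) ->
  continuity_2d_pt (fun s t => f (x0 + exp s * cos t) (y0 + exp s * sin t)) s t.
Proof.
  intros H. apply continuity_2d_pt_filterlim. apply continuity_2d_pt_filterlim in H.
  apply (continuous_comp_2 (fun p : R * R => x0 + exp (fst p) * cos (snd p))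
                           (fun p : R * R => y0 + exp (fst p) * sin (snd p)) f (s, t)).
  - assert (C : cont (fun p : R * R => x0 + exp (fst p) * cos (snd p))) by cont. apply C.
  - assert (C : cont (fun p : R * R => y0 + exp (fst p) * sin (snd p))) by cont. apply C.
  - exact H.
Qed.

Lemma jet_logpolar_cont_at x0 y0 J s t :
  jet_at J (x0 + exp s * cos t) (y0 + exp s * sin t) ->
  jet_cont_at J (x0 + exp s * cos t) (y0 + exp s * sin t) ->
  jet_cont_at (jet_logpolar x0 y0 J) s t.
Proof.
  intros [_ [Hx Hy]] [Cxx [Cxy [Cyx Cyy]]].
  apply differentiable_pt_lim_continuity, continuity_pull in Hx. apply differentiable_pt_lim_continuity, continuity_pull in Hy.
  apply continuity_pull in Cxx, Cxy, Cyx, Cyy.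
  assert (Cc : continuity_2d_pt (fun s t => exp s * cos t) s t) by apply (differentiable_pt_lim_continuity _ _ _ _ _ (differentiable_pt_lim_expcos s t)).
  assert (Cs : continuity_2d_pt (fun s t => exp s * sin t) s t) by apply (differentiable_pt_lim_continuity _ _ _ _ _ (differentiable_pt_lim_expsin s t)).
  unfold jet_cont_at, jet_logpolar; simpl.
  repeat match goal with
  | |- _ /\ _ => split
  | |- continuity_2d_pt (fun s t => _ + _) _ _ => apply continuity_2d_pt_plus
  | |- continuity_2d_pt (fun s t => _ - _) _ _ => apply continuity_2d_pt_minus
  | |- continuity_2d_pt (fun s t => - _) _ _ => apply continuity_2d_pt_opp
  | H : continuity_2d_pt ?f ?s ?t |- continuity_2d_pt ?f ?s ?t => exact H
  | |- continuity_2d_pt (fun s t => _ * _) _ _ => apply continuity_2d_pt_mult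
  end.
Qed.

Definition jet_add_linear (a : R) (J : jet) : jet :=
  {| j0 := fun s t => j0 J s t + a * s; jx := fun s t => jx J s t + a; jy := jy J;
     jxx := jxx J; jxy := jxy J; jyx := jyx J; jyy := jyy J |}.

Lemma jet_add_linear_at a J x y : jet_at J x y -> jet_at (jet_add_linear a J) x y.
Proof.
  intros [H0 [Hx Hy]]. split; [ | split; [ | exact Hy]]; simpl.
  - eapply differentiable_pt_lim_eq.
    + apply (differentiable_pt_lim_plus (j0 J) (fun s _ => a * s)) with (1 := H0).
      apply (differentiable_pt_lim_mult (fun _ _ => a) (fun s _ => s)); [apply differentiable_pt_lim_const | apply differentiable_pt_lim_id1].
    + ring.
    + ring.
  - eapply differentiable_pt_lim_eq.
    + apply (differentiable_pt_lim_plus (jx J) (fun _ _ => a)) with (1 := Hx). apply differentiable_pt_lim_const.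
    + ring.
    + ring.
Qed.

Definition jet_clamp (t1 : R) (J : jet) : jet :=
  let c f := fun s t : R => f (Rmax t1 s) t : R in
  {| j0 := c (j0 J); jx := c (jx J); jy := c (jy J);
     jxx := c (jxx J); jxy := c (jxy J); jyx := c (jyx J); jyy := c (jyy J) |}.

Lemma differentiable_pt_lim_clamp t1 f x y a b : t1 < x -> differentiable_pt_lim f x y a b ->
  differentiable_pt_lim (fun s t => f (Rmax t1 s) t) x y a b.
Proof.
  intros Hx. apply differentiable_pt_lim_ext.
  apply locally_2d_locally.
  assert (H : open (fun p : R * R => t1 < fst p)).
  { apply (open_comp fst (fun s => t1 < s)); [ | apply open_gt]. intros [s t] _. apply continuous_fst. }
  apply Hierarchy.filter_imp with (2 := H (x, y) Hx). intros p Hp.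
  rewrite Rmax_right; [reflexivity | now apply Rlt_le].
Qed.

Lemma jet_clamp_at t1 J x y : t1 < x -> jet_at J x y -> jet_at (jet_clamp t1 J) x y.
Proof.
  intros Hx [H0 [H1 H2]]. unfold jet_at, jet_clamp; simpl.
  rewrite Rmax_right by lra. repeat split; now apply differentiable_pt_lim_clamp.
Qed.

Lemma cont_Rmax t1 : cont (Rmax t1).
Proof.
  apply cont_ext with (fun x => / 2 * (t1 + x + Rabs (x - t1))).
  - intros x. unfold Rmax. destruct (Rle_dec t1 x).
    + rewrite Rabs_right by lra. field.
    + rewrite Rabs_left by lra. field.
  - assert (C : cont Rabs) by (intros x; apply continuous_Rabs). cont.
Qed.

Lemma cont2_clamp t1 f : (forall x y, t1 <= x -> continuity_2d_pt f x y) ->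
  cont2 (fun s t => f (Rmax t1 s) t).
Proof.
  intros H [x y]. pose proof (cont_Rmax t1) as Cm.
  apply (continuous_comp_2 (fun p : R * R => Rmax t1 (fst p)) (fun p : R * R => snd p) f (x, y)).
  - assert (C : cont (fun p : R * R => Rmax t1 (fst p))) by cont. apply C.
  - apply continuous_snd.
  - apply continuity_2d_pt_filterlim, H, Rmax_l.
Qed.

Lemma jet_clamp_cont t1 J :
  (forall x y, t1 <= x -> jet_at J x y /\ jet_cont_at J x y) -> jet_cont (jet_clamp t1 J).
Proof.
  intros H. unfold jet_cont, jet_clamp; simpl.
  repeat split; apply cont2_clamp; intros x y Hx;
    destruct (H x y Hx) as [[H0 [H1 H2]] [H3 [H4 [H5 H6]]]]; trivial;
    eapply differentiable_pt_lim_continuity; eassumption.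
Qed.

(** Adding [a s] to [u] in log-polar coordinates makes it positive without
    changing its Laplacian. *)
Definition cylinder_jet (a t1 : R) (u : R * R -> R) : jet :=
  jet_clamp t1 (jet_add_linear a (jet_logpolar 0 0 (jet_of u))).

Definition polar (s t : R) : R * R := (exp s * cos t, exp s * sin t).

Lemma Cmod_polar s t : Cmod (polar s t) = exp s.
Proof.
  unfold Cmod, polar; cbn [fst snd].
  replace ((exp s * cos t) ^ 2 + (exp s * sin t) ^ 2)
    with (exp s * exp s * (sin t * sin t + cos t * cos t)) by ring.
  pose proof (sin2_cos2 t) as E. unfold Rsqr in E. rewrite E, Rmult_1_r.
  apply sqrt_square, Rlt_le, exp_pos.
Qed.

Lemma polar_exists y : 0 < Cmod y -> exists t, y = polar (ln (Cmod y)) t.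
Proof.
  intros Hy. unfold polar. rewrite exp_ln by trivial.
  set (r := Cmod y) in *. destruct y as [p q].
  assert (E : p * p + q * q = r * r).
  { unfold r, Cmod; cbn [fst snd]. rewrite sqrt_sqrt; [ring | ].
    apply Rplus_le_le_0_compat; apply pow2_ge_0. }
  set (c := p / r). set (d := q / r).
  assert (Ep : p = r * c) by (unfold c; field; lra).
  assert (Eq : q = r * d) by (unfold d; field; lra).
  assert (Ecd : c * c + d * d = 1).
  { apply Rmult_eq_reg_l with (r * r); [ | nra]. rewrite Ep, Eq in E. lra. }
  assert (Hc : -1 <= c <= 1) by (split; nra).
  assert (Es : 1 - c² = d * d) by (unfold Rsqr; lra).
  destruct (Rle_or_lt 0 d) as [Hd | Hd].
  - exists (acos c). rewrite cos_acos, sin_acos, Es, sqrt_square by trivial. congruence.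
  - exists (- acos c). rewrite cos_neg, sin_neg, cos_acos, sin_acos, Es by trivial.
    replace (d * d) with (- d * - d) by ring. rewrite sqrt_square, Ropp_involutive by lra. congruence.
Qed.

Lemma open_Cmod_gt M : open (fun y : R * R => M < Cmod y).
Proof.
  apply (open_comp Cmod (fun r => M < r)); [ | apply open_gt].
  assert (C : cont (fun y : R * R => sqrt (fst y ^ 2 + snd y ^ 2))) by cont.
  intros y _. apply C.
Qed.

Lemma open_Cmod_lt M : open (fun y : R * R => Cmod y < M).
Proof.
  apply (open_comp Cmod (fun r => r < M)); [ | apply open_lt].
  assert (C : cont (fun y : R * R => sqrt (fst y ^ 2 + snd y ^ 2))) by cont.
  intros y _. apply C.
Qed.

(** Discs around the origin cover the plane. *)
Lemma compact_bounded (K : R * R -> Prop) : compact_set K ->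
  exists M, 0 < M /\ forall y, K y -> Cmod y < M.
Proof.
  intros HK.
  destruct (HK (fun U => exists M, U = fun y => Cmod y < M)) as [l [Hl Hcov]].
  - intros U [M ->]. apply open_Cmod_lt.
  - intros y _. exists (fun z => Cmod z < Cmod y + 1). split; [now exists (Cmod y + 1) | ].
    apply Rlt_plus_1.
  - assert (Hb : exists M, 0 < M /\ forall U y, In U l -> U y -> Cmod y < M).
    { clear Hcov. induction l as [ | U l IH].
      - exists 1. split; [lra | ]. intros U y [].
      - destruct IH as [M [HM IH]]; [intros V HV; apply Hl; now right | ].
        destruct (Hl U (or_introl eq_refl)) as [N ->].
        exists (Rmax M N). split; [apply Rlt_le_trans with (1 := HM), Rmax_l | ].
        intros V y [<- | HV] Hy.
        + apply Rlt_le_trans with (1 := Hy), Rmax_r.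
        + apply Rlt_le_trans with (1 := IH V y HV Hy), Rmax_l. }
    destruct Hb as [M [HM Hb]]. exists M. split; trivial.
    intros y Hy. destruct (Hcov y Hy) as [U [HU HUy]]. now apply (Hb U).
Qed.

Lemma cylinder_jet_j0 a t1 u s t : t1 <= s ->
  j0 (cylinder_jet a t1 u) s t = u (polar s t) + a * s.
Proof.
  intros Hs. unfold cylinder_jet, polar; simpl. now rewrite Rmax_right, !Rplus_0_l.
Qed.

Lemma lap_cylinder_jet a t1 u s t :
  lap (cylinder_jet a t1 u) s t
  = exp (Rmax t1 s) * exp (Rmax t1 s) * laplacian u (polar (Rmax t1 s) t).
Proof.
  transitivity (lap (jet_logpolar 0 0 (jet_of u)) (Rmax t1 s) t); [reflexivity | ].
  rewrite lap_logpolar, laplacian_jet_of, !Rplus_0_l. reflexivity.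
Qed.

Lemma cylinder_jet_superharmonic a rho t1 u : 0 < rho -> ln rho < t1 ->
  C2_on (fun y => rho < Cmod y) u ->
  (forall y, rho < Cmod y -> 0 <= - laplacian u y) ->
  (forall y, rho < Cmod y -> u y > - a * ln (Cmod y)) ->
  cylinder_superharmonic (cylinder_jet a t1 u) (fun x y => - lap (cylinder_jet a t1 u) x y) t1.
Proof.
  intros Hrho Ht1 Hu Hlap Hlow.
  assert (Hpol : forall x y, t1 <= x -> rho < Cmod (polar x y)).
  { intros x y Hx. rewrite Cmod_polar, <- (exp_ln rho) by trivial. apply exp_increasing. lra. }
  assert (Hat : forall x y, t1 <= x ->
     jet_at (jet_add_linear a (jet_logpolar 0 0 (jet_of u))) x y /\
     jet_cont_at (jet_add_linear a (jet_logpolar 0 0 (jet_of u))) x y).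
  { intros x y Hx.
    destruct (jet_of_at _ u (0 + exp x * cos y) (0 + exp x * sin y) (open_Cmod_gt rho) Hu) as [H1 H2].
    - rewrite !Rplus_0_l. now apply Hpol.
    - split; [now apply jet_add_linear_at, jet_logpolar_at | ].
      now apply (jet_logpolar_cont_at 0 0 (jet_of u)). }
  assert (Cj : jet_cont (cylinder_jet a t1 u)) by now apply jet_clamp_cont.
  constructor; trivial.
  - destruct Cj as [_ [_ [_ [Cxx [_ [_ Cyy]]]]]]. unfold lap. cont.
  - intros x y Hx. split; [ | ring]. apply jet_clamp_at; trivial. apply Hat. lra.
  - intros x y. pose proof (Rmax_l t1 x) as Hm.
    change (0 <= j0 (jet_add_linear a (jet_logpolar 0 0 (jet_of u))) (Rmax t1 x) y).
    pose proof (Hlow _ (Hpol _ y Hm)) as H. rewrite Cmod_polar, ln_exp in H.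
    simpl. rewrite !Rplus_0_l. unfold polar in H. lra.
  - intros x y. rewrite lap_cylinder_jet.
    pose proof (Hlap _ (Hpol _ y (Rmax_l t1 x))). pose proof (exp_pos (Rmax t1 x)).
    assert (0 <= exp (Rmax t1 x) * exp (Rmax t1 x)) by nra. nra.
  - intros x y. unfold cylinder_jet; simpl. now rewrite cos_plus_2PI, sin_plus_2PI.
  - intros x y. unfold cylinder_jet; simpl. now rewrite cos_plus_2PI, sin_plus_2PI.
  - intros x y. rewrite !lap_cylinder_jet. unfold polar. now rewrite cos_plus_2PI, sin_plus_2PI.
Qed.

Theorem theorem2p6 (a lam : R) (ha : 0 < a) (hlam : 0 < lam)
  (K : R * R -> Prop) (hK : compact_set K)
  (u v : R * R -> R)
  (hu : C2_on (fun y => ~ K y) u) (hv : C2_on (fun y => ~ K y) v)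
  (hDu : forall y, ~ K y ->
     0 <= - laplacian u y <= rpow (Cmod y) a * exp (rpow (Rabs (v y)) lam))
  (hDv : forall y, ~ K y ->
     0 <= - laplacian v y <= rpow (Cmod y) a * exp (u y))
  (* At the origin the lower bounds are void: [log |y|] is undefined there. *)
  (hbu : forall y, ~ K y -> y <> (0, 0) -> u y > - a * ln (Cmod y))
  (hbv : forall y, ~ K y -> y <> (0, 0) -> v y > - a * ln (Cmod y)) :
  is_bigO_plus_littleo at_infinity
    (fun y => ln (Cmod y)) (fun y => rpow (ln (Cmod y)) lam) u /\
  is_bigO at_infinity (fun y => ln (Cmod y)) v.
Proof.
  destruct (compact_bounded K hK) as [rho [Hrho HK]].
  assert (HnK : forall y, rho < Cmod y -> ~ K y).
  { intros y Hy Ky. pose proof (HK y Ky). lra. }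
  assert (Hn0 : forall y, rho < Cmod y -> y <> (0, 0)).
  { intros y Hy E. rewrite E in Hy. change (rho < Cmod 0) in Hy. rewrite Cmod_0 in Hy. lra. }
  set (t1 := ln rho + 1).
  set (Ju := cylinder_jet a t1 u). set (Jv := cylinder_jet a t1 v).
  assert (HU : cylinder_superharmonic Ju (fun x y => - lap Ju x y) t1).
  { apply (cylinder_jet_superharmonic a rho); trivial; [unfold t1; lra | | | ].
    - intros y Hy. apply hu, HnK, Hy.
    - intros y Hy. apply hDu, HnK, Hy.
    - intros y Hy. apply hbu; auto. }
  assert (HV : cylinder_superharmonic Jv (fun x y => - lap Jv x y) t1).
  { apply (cylinder_jet_superharmonic a rho); trivial; [unfold t1; lra | | | ].
    - intros y Hy. apply hv, HnK, Hy.
    - intros y Hy. apply hDv, HnK, Hy.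
    - intros y Hy. apply hbv; auto. }
  assert (Hpol : forall x y, t1 <= x -> ~ K (polar x y)).
  { intros x y Hx. apply HnK. rewrite Cmod_polar, <- (exp_ln rho) by trivial.
    apply exp_increasing. unfold t1 in Hx. lra. }
  assert (Hrhs : forall w x y z, t1 < x -> - laplacian w (polar x y) <= rpow (Cmod (polar x y)) a * z ->
     - lap (cylinder_jet a t1 w) x y <= exp ((a + 2) * x) * z).
  { intros w x y z Hx H. rewrite lap_cylinder_jet, Rmax_right by lra.
    rewrite Cmod_polar, rpow_pos in H by apply exp_pos.
    unfold Rpower in H. rewrite ln_exp in H.
    replace ((a + 2) * x) with (x + x + a * x) by ring. rewrite !exp_plus.
    replace (- (exp x * exp x * laplacian w (polar x y)))
      with (exp x * exp x * - laplacian w (polar x y)) by ring.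
    rewrite (Rmult_assoc (exp x * exp x)). apply Rmult_le_compat_l; trivial.
    apply Rmult_le_pos; apply Rlt_le, exp_pos. }
  destruct (cylinder_system a (a + 2) lam Ju _ Jv _ t1 ha ltac:(lra) hlam HU HV)
    as [[C [T HvC]] [C' HuC]].
  { intros x y Hx. apply Hrhs; trivial.
    unfold Jv. rewrite cylinder_jet_j0 by lra.
    replace (v (polar x y) + a * x - a * x) with (v (polar x y)) by ring.
    apply hDu, Hpol. lra. }
  { intros x y Hx. apply Hrhs; trivial.
    unfold Ju. rewrite cylinder_jet_j0 by lra.
    replace (u (polar x y) + a * x - a * x) with (u (polar x y)) by ring.
    apply hDv, Hpol. lra. }
  assert (Hfar : forall S y, exp (Rmax S (Rmax t1 1)) < Cmod y ->
     exists x t, y = polar x t /\ S <= x /\ t1 <= x /\ 1 <= x /\ ln (Cmod y) = x /\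
       - a * x < u y /\ - a * x < v y).
  { intros S y Hy.
    assert (Hpos : 0 < Cmod y) by (apply Rlt_trans with (2 := Hy), exp_pos).
    assert (Hl : Rmax S (Rmax t1 1) < ln (Cmod y)).
    { rewrite <- (ln_exp (Rmax S (Rmax t1 1))). apply ln_increasing; [apply exp_pos | trivial]. }
    destruct (polar_exists y Hpos) as [t Et].
    pose proof (Rmax_l S (Rmax t1 1)). pose proof (Rmax_r S (Rmax t1 1)).
    pose proof (Rmax_l t1 1). pose proof (Rmax_r t1 1).
    assert (Hy0 : rho < Cmod y).
    { rewrite <- (exp_ln rho), <- (exp_ln (Cmod y)) by trivial. apply exp_increasing.
      unfold t1 in *. lra. }
    exists (ln (Cmod y)), t. repeat split; trivial; try lra.
    - apply hbu; auto.
    - apply hbv; auto. }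
  split.
  (* The excess of [u] over [C' ln |y|] is the little-o part. *)
  - exists (fun y => Rmin (u y) (C' * ln (Cmod y))), (fun y => Rmax 0 (u y - C' * ln (Cmod y))).
    split; [ | split].
    + intros y. unfold Rmin, Rmax.
      destruct (Rle_dec (u y) (C' * ln (Cmod y))), (Rle_dec 0 (u y - C' * ln (Cmod y))); lra.
    + exists (Rabs C' + a), (exp (Rmax 0 (Rmax t1 1))). intros y Hy.
      destruct (Hfar 0 y Hy) as [x [t [Ey [_ [Hx1 [Hx2 [-> [Hux _]]]]]]]].
      rewrite (Rabs_right x) by lra.
      pose proof (Rle_abs C'). pose proof (Rle_abs (- C')) as HC'. rewrite Rabs_Ropp in HC'.
      assert (C' * x <= Rabs C' * x) by (apply Rmult_le_compat_r; lra).
      assert (- C' * x <= Rabs C' * x) by (apply Rmult_le_compat_r; lra).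
      assert (0 <= a * x) by (apply Rmult_le_pos; lra).
      assert (0 <= Rabs C' * x) by (apply Rmult_le_pos; [apply Rabs_pos | lra]).
      apply Rabs_le. unfold Rmin. destruct (Rle_dec (u y) (C' * x)); lra.
    + intros eps. destruct (HuC eps (cond_pos eps)) as [S HS].
      exists (exp (Rmax S (Rmax t1 1))). intros y Hy.
      destruct (Hfar S y Hy) as [x [t [Ey [HSx [Hx1 [Hx2 [-> [Hux _]]]]]]]].
      change (Rabs (Rmax 0 (u y - C' * x)) <= eps * Rabs (rpow x lam)).
      rewrite rpow_pos by lra.
      assert (HP : 0 < Rpower x lam) by apply exp_pos.
      rewrite (Rabs_right (Rpower x lam)) by lra.
      rewrite Rabs_right by (apply Rle_ge, Rmax_l).
      apply Rmax_lub.
      * apply Rmult_le_pos; [apply Rlt_le, cond_pos | lra].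
      * pose proof (HS x t HSx) as H. unfold Ju in H. rewrite cylinder_jet_j0, <- Ey in H by trivial.
        assert (0 <= a * x) by (apply Rmult_le_pos; lra). lra.
  - exists (Rabs C + a), (exp (Rmax T (Rmax t1 1))). intros y Hy.
    destruct (Hfar T y Hy) as [x [t [Ey [HTx [Hx1 [Hx2 [-> [_ Hvx]]]]]]]].
    pose proof (HvC x t HTx) as H. unfold Jv in H. rewrite cylinder_jet_j0, <- Ey in H by trivial.
    rewrite (Rabs_right x) by lra. pose proof (Rle_abs C).
    assert (C * x <= Rabs C * x) by (apply Rmult_le_compat_r; lra).
    assert (0 <= a * x) by (apply Rmult_le_pos; lra).
    assert (0 <= Rabs C * x) by (apply Rmult_le_pos; [apply Rabs_pos | lra]).
    apply Rabs_le. lra.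
Qed.
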